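(* The following mappings are continuous: (i) the sesquilinear mapping $V:\mathcal{K}_{1}(\mathbb{R}^n)\times \mathcal{K}_{1}(\mathbb{R}^n)\to \mathcal{K}_{1}(\mathbb{R}^n)\widehat{\otimes}\, \mathcal{U}(\mathbb{C}^n)$, $(\varphi,\psi)\mapsto V_\psi \varphi$; (ii) the bilinear mapping $V^{*}:(\mathcal{K}_{1}(\mathbb{R}^n)\widehat{\otimes}\, \mathcal{U}(\mathbb{C}^n))\times\mathcal{K}_{1}(\mathbb{R}^n)\to \mathcal{K}_{1}(\mathbb{R}^n)$, $(\Phi,\psi)\mapsto V_\psi^*\Phi$.
   Context: $\mathcal{K}_1(\mathbb{R}^n)$ is the Fréchet space of all $\varphi\in C^\infty(\mathbb{R}^n)$ such that $\nu_k(\varphi):=\sup_{t\in\mathbb{R}^n,|\alpha|\le k}e^{k|t|}|\varphi^{(\alpha)}(t)|<\infty$ for all $k\in\mathbb{N}_0$, topologized by these norms. Let $\Pi_k=\mathbb{R}^n+i[-k,k]^n\subset\mathbb{C}^n$. $\mathcal{U}(\mathbb{C}^n)$ is the space of entire functions $\phi$ on $\mathbb{C}^n$ with $\sup_{z\in\Pi_k}(1+|z|^2)^{k/2}|\phi(z)|<\infty$ for all $k\in\mathbb{N}_0$, with these norms. $\mathcal{K}_1(\mathbb{R}^n)\widehat\otimes\,\mathcal{U}(\mathbb{C}^n)$ is the completed topological tensor product ($\pi$- and $\varepsilon$-topologies agree by nuclearity); concretely, it is the space of functions $\Phi(x,z)$ on $\mathbb{R}^n\times\mathbb{C}^n$,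 smooth in $x$ and entire in $z$, with topology given by the norms $\rho_k(\Phi)=\sup_{(x,z)\in\mathbb{R}^n\times\Pi_k,\,|\alpha|\le k}e^{k|x|}(1+|z|^2)^{k/2}|\partial_x^\alpha\Phi(x,z)|$, $k\in\mathbb{N}_0$. The short-time Fourier transform of $\varphi\in\mathcal{K}_1(\mathbb{R}^n)$ with window $\psi\in\mathcal{K}_1(\mathbb{R}^n)$ is $V_\psi \varphi(x,z)=\int_{\mathbb{R}^n}\varphi(t)\overline{\psi(t-x)}e^{-2\pi i z\cdot t}\,dt$, $x\in\mathbb{R}^n$, $z\in\mathbb{C}^n$ (entire in $z$), and $V_\psi^*\Phi(t)=\iint_{\mathbb{R}^{2n}}\Phi(x,\xi)\psi(t-x)e^{2\pi i\xi\cdot t}\,dx\,d\xi$. *)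

(* Defs.v *)
From HB Require Import structures.
From mathcomp Require Import all_boot all_order all_algebra sesquilinear.
From mathcomp Require Import complex.
From mathcomp Require Import all_classical all_reals all_analysis.

Set Implicit Arguments.
Unset Strict Implicit.
Unset Printing Implicit Defensive.

Import Order.TTheory GRing.Theory Num.Theory.
Import numFieldNormedType.Exports.
Import ComplexField.Normc.

Local Open Scope classical_set_scope.
Local Open Scope ring_scope.
Local Open Scope complex_scope.

(* The usual topology of the complex plane, and R[i] as a normed module over
   itself, so that differentiability on 'rV[R[i]]_n is complex
   differentiability. *)
HB.instance Definition _ (R : rcfType) := NormedModule.copy R[i] R[i]^o.

Section ComplexFunctions.
Variable R : realType.

Definition cexp (w : R[i]) : R[i] :=
  (expR (complex.Re w))%:C * (cos (complex.Im w) +i* sin (complex.Im w)).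

Definition cintegral d (T : measurableType d)
    (mu : {measure set T -> \bar R}) (f : T -> R[i]) : R[i] :=
  (\int[mu]_x complex.Re (f x)) +i* (\int[mu]_x complex.Im (f x)).

Definition cintegrable d (T : measurableType d)
    (mu : {measure set T -> \bar R}) (f : T -> R[i]) : Prop :=
  mu.-integrable setT (fun x => (complex.Re (f x))%:E) /\
  mu.-integrable setT (fun x => (complex.Im (f x))%:E).

End ComplexFunctions.

(* The library has no Lebesgue measure on R^n: it is built here by iterated
   products on n-tuples, which carry the product sigma-algebra, i.e. the Borel
   sets of R^n. See lebesgue_tuple_box below. *)
Section LebesgueMeasure.
Variable R : realType.

Definition Rtuple (n : nat) := n.-tuple (measurableTypeR R).

Definition row_of_tuple n (s : Rtuple n) : 'rV[R]_n := \row_i (tnth s i : R).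

Section step.
Variables (n : nat) (mu : {sigma_finite_measure set (Rtuple n) -> \bar R}).

Definition cons_pair (p : measurableTypeR R * Rtuple n) : Rtuple n.+1 :=
  [tuple of p.1 :: p.2].

Definition lebesgue_step : set (Rtuple n.+1) -> \bar R :=
  pushforward (lebesgue_measure \x mu)%E cons_pair.

Lemma measurable_cons_pair : measurable_fun setT cons_pair.
Proof. exact: (measurable_cons measurable_fst measurable_snd). Qed.


Let lebesgue_step0 : lebesgue_step set0 = 0%E.
Proof. by rewrite /lebesgue_step /pushforward preimage_set0 measure0. Qed.

Let lebesgue_step_ge0 A : (0 <= lebesgue_step A)%E.
Proof. exact: (measure_ge0 (lebesgue_measure \x mu)%E). Qed.

Let lebesgue_step_sigma_additive : semi_sigma_additive lebesgue_step.
Proof.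
move=> F mF tF mUF; rewrite /lebesgue_step /pushforward preimage_bigcup.
apply: measure_semi_sigma_additive.
- by move=> k; rewrite -[X in measurable X]setTI; exact: measurable_cons_pair.
- apply/trivIsetP => /= i j _ _ ij; rewrite -preimage_setI.
  by move/trivIsetP : tF => /(_ _ _ _ _ ij) ->//; rewrite preimage_set0.
- rewrite -preimage_bigcup -[X in measurable X]setTI.
  exact: measurable_cons_pair.
Qed.

HB.instance Definition _ := isMeasure.Build _ _ _ lebesgue_step
  lebesgue_step0 lebesgue_step_ge0 lebesgue_step_sigma_additive.

Let lebesgue_step_sigma_finite : sigma_finite setT lebesgue_step.
Proof.
have [F FT mF] : sigma_finite setT (lebesgue_measure \x mu)%E.
  have /sigma_finiteP[F [TF ndF Foo]] := sigma_finiteT (@lebesgue_measure R).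
  have /sigma_finiteP[G [TG ndG Goo]] := sigma_finiteT mu.
  exists (fun k => F k `*` G k).
    rewrite -setXTT TF TG predeqE => -[x y]; split.
      move=> [/= [k _ Fkx] [j _ Gjy]]; exists (maxn k j) => //; split.
      - by move: x Fkx; exact/subsetPset/ndF/leq_maxl.
      - by move: y Gjy; exact/subsetPset/ndG/leq_maxr.
    by move=> [k _ []/= ? ?]; split; exists k.
  move=> k; have [? ?] := Foo k; have [? ?] := Goo k.
  split; first exact: measurableX.
  by rewrite product_measure1E// lte_mul_pinfty// ge0_fin_numE.
pose split_tuple (s : Rtuple n.+1) : measurableTypeR R * Rtuple n :=
  (thead s, [tuple of behead s]).
have mS : measurable_fun setT split_tuple.
  apply: measurable_fun_pair; first exact: measurable_tnth.
  exact: measurable_behead.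
have cons_pairK : cancel cons_pair split_tuple.
  by case=> a s; congr pair; apply/val_inj.
exists (fun k => split_tuple @^-1` F k).
  by rewrite -preimage_bigcup -FT preimage_setT.
move=> k; have [mFk Fkoo] := mF k; split.
  by rewrite -[X in measurable X]setTI; exact: mS.
rewrite /lebesgue_step /pushforward -comp_preimage.
by rewrite (_ : _ \o _ = id)//; apply/funext => p /=; rewrite cons_pairK.
Qed.

HB.instance Definition _ := Measure_isSigmaFinite.Build _ _ _ lebesgue_step
  lebesgue_step_sigma_finite.
End step.

Fixpoint lebesgue_tuple n : {sigma_finite_measure set (Rtuple n) -> \bar R} :=
  match n with
  | 0 => \d_([tuple] : Rtuple 0)
  | m.+1 => lebesgue_step (lebesgue_tuple m)
  end.

Lemma lebesgue_tuple_box n (A : 'I_n -> set (measurableTypeR R)) :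
  (forall i, measurable (A i)) ->
  lebesgue_tuple n [set s | forall i, A i (tnth s i)] =
  (\prod_(i < n) lebesgue_measure (A i))%E.
Proof.
elim: n A => [|n IHn] A mA.
  by rewrite big_ord0 /= diracE mem_set// => -[].
have mB : measurable [set s : Rtuple n | forall i, A (lift ord0 i) (tnth s i)].
  rewrite [X in measurable X](_ : _ =
      \bigcap_(i in [set: 'I_n]) ((@tnth n (measurableTypeR R) ^~ i) @^-1`
        A (lift ord0 i))); last first.
    by apply/seteqP; split => s /= As i; [move=> _; exact: As|exact: As].
  apply: fin_bigcap_measurable => // i _.
  by rewrite -[X in measurable X]setTI; exact: measurable_tnth.
rewrite big_ord_recl -(IHn (A \o lift ord0))//= /lebesgue_step /pushforward.
rewrite -product_measure1E//; congr product_measure1.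
apply/seteqP; split => -[a s] /= As.
  split; first exact: (As ord0).
  by move=> i; have := As (lift ord0 i); rewrite tnthS.
move=> i; case: (unliftP ord0 i) => [j ->|->]; last exact: As.1.
by rewrite tnthS; exact: As.2.
Qed.

End LebesgueMeasure.

Section Smooth.
Variables (R : realType) (n : nat).
Implicit Types (f g : 'rV[R]_n -> R[i]) (i : 'I_n).

(* Derivatives of complex-valued functions of real variables are taken
   separately on the real and imaginary parts, since R[i] is not declared as a
   normed module over R. *)
Definition cderivable i f (t : 'rV[R]_n) : Prop :=
  derivable (fun x => complex.Re (f x)) t 'e_i /\
  derivable (fun x => complex.Im (f x)) t 'e_i.

Definition cpartial i f (t : 'rV[R]_n) : R[i] :=
  'D_'e_i (fun x => complex.Re (f x)) t +i*
  'D_'e_i (fun x => complex.Im (f x)) t.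

(* Multi-indices are finite functions 'I_n -> nat; mpartial alpha applies the
   first partial derivative alpha 0 times, and so on up to the last one. *)
Definition mdeg (alpha : {ffun 'I_n -> nat}) : nat := (\sum_i alpha i)%N.

Definition mpartial (alpha : {ffun 'I_n -> nat}) f : 'rV[R]_n -> R[i] :=
  foldr (fun i g => iter (alpha i) (cpartial i) g) f (enum 'I_n).

Fixpoint classC (r : nat) f : Prop :=
  match r with
  | 0 => continuous f
  | q.+1 => continuous f /\
      forall i, (forall t, cderivable i f t) /\ classC q (cpartial i f)
  end.

Definition smooth f : Prop := forall r, classC r f.

(* The library norm on row vectors is the sup norm; the weights below use the
   Euclidean one. *)
Definition enorm (t : 'rV[R]_n) : R := Num.sqrt (\sum_i t 0 i ^+ 2).

Definition cenorm (z : 'rV[R[i]]_n) : R :=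
  Num.sqrt (\sum_i normc (z 0 i) ^+ 2).

Lemma Re_lin (a : R[i]) f g :
  (fun x => complex.Re ((a *: f + g) x)) =
  complex.Re a \*: (fun x => complex.Re (f x)) -
  complex.Im a \*: (fun x => complex.Im (f x)) + (fun x => complex.Re (g x)).
Proof.
apply/funext => x.
rewrite (_ : (a *: f + g) x = a * f x + g x)//.
by rewrite !fctE/=; case: a (f x) (g x) => ? ? [? ?] [].
Qed.

Lemma Im_lin (a : R[i]) f g :
  (fun x => complex.Im ((a *: f + g) x)) =
  complex.Re a \*: (fun x => complex.Im (f x)) +
  complex.Im a \*: (fun x => complex.Re (f x)) + (fun x => complex.Im (g x)).
Proof.
apply/funext => x.
rewrite (_ : (a *: f + g) x = a * f x + g x)//.
by rewrite !fctE/=; case: a (f x) (g x) => ? ? [? ?] [].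
Qed.

Lemma cderivable_lin i (a : R[i]) f g t :
  cderivable i f t -> cderivable i g t -> cderivable i (a *: f + g) t.
Proof.
move=> [fr fi] [gr gi]; split.
  rewrite Re_lin.
  exact: derivableD (derivableB (derivableZ fr) (derivableZ fi)) gr.
rewrite Im_lin.
exact: derivableD (derivableD (derivableZ fi) (derivableZ fr)) gi.
Qed.

Lemma cpartial_lin i (a : R[i]) f g :
  (forall t, cderivable i f t) -> (forall t, cderivable i g t) ->
  cpartial i (a *: f + g) = a *: cpartial i f + cpartial i g.
Proof.
move=> df dg; apply/funext => t; have [fr fi] := df t; have [gr gi] := dg t.
rewrite /cpartial Re_lin Im_lin.
have Zd (b : R) (h : 'rV[R]_n -> R) : derivable h t 'e_i ->
  derivable (b \*: h) t 'e_i by exact: derivableZ.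
have arr := Zd (complex.Re a) _ fr; have aii := Zd (complex.Im a) _ fi.
have ari := Zd (complex.Re a) _ fi; have air := Zd (complex.Im a) _ fr.
rewrite (deriveD (derivableB arr aii) gr) (deriveB arr aii).
rewrite (deriveD (derivableD ari air) gi) (deriveD ari air).
rewrite (deriveZ _ fr) (deriveZ _ fi) (deriveZ _ fi) (deriveZ _ fr).
by case: (a).
Qed.

Lemma classC_lin r (a : R[i]) f g :
  classC r f -> classC r g -> classC r (a *: f + g).
Proof.
have clin (h k : 'rV[R]_n -> R[i]) : continuous h -> continuous k ->
    continuous (a *: h + k).
  move=> ch ck x; apply: continuousD; last exact: ck.
  by apply: continuousM; [exact: cst_continuous|exact: ch].
elim: r f g => [|r IHr] f g /=; first by move=> cf cg; exact: clin cf cg.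
move=> [cf df] [cg dg]; split; first exact: clin cf cg.
move=> i; have [dfi rfi] := df i; have [dgi rgi] := dg i; split.
  by move=> t; exact: cderivable_lin.
by rewrite cpartial_lin//; exact: IHr.
Qed.

Lemma classC0 r : classC r 0.
Proof.
elim: r => [|r IHr]; first exact: cst_continuous.
split; first exact: cst_continuous.
move=> i; split; first by move=> t; split; exact: derivable_cst.
rewrite (_ : cpartial i 0 = 0)//; apply/funext => t.
by rewrite /cpartial !derive_cst.
Qed.

Lemma smooth_lin (a : R[i]) f g : smooth f -> smooth g -> smooth (a *: f + g).
Proof. by move=> sf sg r; exact: classC_lin. Qed.

Lemma smooth_cpartial i f : smooth f -> smooth (cpartial i f).
Proof. by move=> sf r; have [_ /(_ i)[]] := sf r.+1. Qed.

Lemma smooth_cderivable i f t : smooth f -> cderivable i f t.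
Proof. by move=> sf; have [_ /(_ i)[]] := sf 1. Qed.

Lemma mpartial_lin alpha (a : R[i]) f g : smooth f -> smooth g ->
  mpartial alpha (a *: f + g) = a *: mpartial alpha f + mpartial alpha g.
Proof.
move=> sf sg; rewrite /mpartial.
pose F h s := foldr (fun i g => iter (alpha i) (cpartial i) g) h s.
suff : forall s, [/\ smooth (F f s), smooth (F g s) &
    F (a *: f + g) s = a *: F f s + F g s] by move=> /(_ (enum 'I_n))[].
elim=> [|i s [sFf sFg Flin]] //=; rewrite Flin.
elim: (alpha i) => [|m [sf' sg' lin']] //=; rewrite lin'; split.
- exact: smooth_cpartial.
- exact: smooth_cpartial.
- by rewrite cpartial_lin// => t; exact: smooth_cderivable.
Qed.

End Smooth.

Section SeminormUniformity.
Variables (R : realType) (V : zmodType) (p : nat -> V -> \bar R).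

(* Finitely many seminorms are controlled at once, so that p need not be
   monotone in its index. *)
Definition seminorm_entourage : set_system (V * V) :=
  [set E | exists k (e : R), 0 < e /\
    forall xy : V * V,
      (forall j, (j <= k)%N -> (p j (xy.1 - xy.2)%R < e%:E)%E) -> E xy].

Lemma seminorm_entourage_filter : Filter seminorm_entourage.
Proof.
split.
- by exists 0%N, 1.
- move=> A B [k [e [e0 Ae]]] [l [d [d0 Bd]]].
  exists (maxn k l), (Num.min e d); split; first by rewrite lt_min e0.
  move=> xy xyp; split.
  + apply: Ae => j jk; have := xyp j (leq_trans jk (leq_maxl _ _)).
    by rewrite EFin_min lt_min => /andP[].
  + apply: Bd => j jk; have := xyp j (leq_trans jk (leq_maxr _ _)).
    by rewrite EFin_min lt_min => /andP[].
- move=> A B AB [k [e [e0 Ae]]]; exists k, e; split => // xy xyp.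
  by apply: AB; exact: Ae.
Qed.

Hypothesis p0 : forall k, (p k 0%R <= 0)%E.
Hypothesis pN : forall k x, (p k (- x)%R <= p k x)%E.
Hypothesis pD : forall k x y, (p k (x + y)%R <= p k x + p k y)%E.

Lemma seminorm_entourage_diagonal E : seminorm_entourage E -> diagonal `<=` E.
Proof.
move=> [k [e [e0 Ee]]] [x y] /= xy; apply: Ee => j _ /=.
by rewrite [x]xy subrr (le_lt_trans (p0 j))// lte_fin.
Qed.

Lemma seminorm_entourage_inv E :
  seminorm_entourage E -> seminorm_entourage E^-1%relation.
Proof.
move=> [k [e [e0 Ee]]]; exists k, e; split => // -[x y] /= xyp.
apply: (Ee (y, x)) => j jk /=; rewrite -opprB.
by apply: le_lt_trans (pN _ _) _; exact: xyp.
Qed.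

Lemma seminorm_entourage_split E : seminorm_entourage E ->
  exists2 D, seminorm_entourage D & (D \; D)%relation `<=` E.
Proof.
move=> [k [e [e0 Ee]]].
exists [set xy | forall j, (j <= k)%N -> (p j (xy.1 - xy.2)%R < (e / 2)%:E)%E].
  by exists k, (e / 2); split => //; rewrite divr_gt0.
move=> [x z] /= [y /= xy yz]; apply: Ee => j jk /=.
rewrite (_ : x - z = (x - y) + (y - z)); last by rewrite addrA subrK.
apply: le_lt_trans (pD _ _ _) _; rewrite [e]splitr EFinD.
by apply: lteD; [exact: xy|exact: yz].
Qed.

End SeminormUniformity.

Section Spaces.
Variables (R : realType) (n : nat).

Definition K1_norm (k : nat) (f : 'rV[R]_n -> R[i]) : \bar R :=
  ereal_sup [set (expR (k%:R * enorm p.1) * normc (mpartial p.2 f p.1))%:E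
    | p in [set p : 'rV[R]_n * {ffun 'I_n -> nat} | (mdeg p.2 <= k)%N]].

Definition K1_pred : {pred 'rV[R]_n -> R[i]} :=
  mem [set f | smooth f /\ forall k, (K1_norm k f < +oo)%E].

Definition entire (h : 'rV[R[i]]_n -> R[i]) : Prop :=
  forall z, differentiable h z.

Definition strip (k : nat) : set 'rV[R[i]]_n :=
  [set z | forall i, `|complex.Im (z 0 i)| <= k%:R].

(* Functions of (x, z) are curried; p.1.1, p.1.2 and p.2 stand for x, z and the
   multi-index. KU_pred describes the completed tensor product of K1 with the
   space of entire functions rapidly decreasing on strips. *)
Definition KU_norm (k : nat) (F : 'rV[R]_n -> 'rV[R[i]]_n -> R[i]) : \bar R :=
  ereal_sup [set (expR (k%:R * enorm p.1.1) *
      (1 + cenorm p.1.2 ^+ 2) `^ (k%:R / 2) *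
      normc (mpartial p.2 (F ^~ p.1.2) p.1.1))%:E
    | p in [set p : 'rV[R]_n * 'rV[R[i]]_n * {ffun 'I_n -> nat} |
              strip k p.1.2 /\ (mdeg p.2 <= k)%N]].

Definition KU_pred : {pred 'rV[R]_n -> 'rV[R[i]]_n -> R[i]} :=
  mem [set F | [/\ forall z, smooth (F ^~ z), forall x, entire (F x)
                 & forall k, (KU_norm k F < +oo)%E]].

Lemma normc_lin (a u v : R[i]) :
  normc (a * u + v) <= normc a * normc u + normc v.
Proof.
by rewrite -normcM -lecR rmorphD /=; exact: (ler_normD (a * u) v).
Qed.

Lemma normcN (u : R[i]) : normc (- u) = normc u.
Proof. by case: u => x y; rewrite /= !sqrrN. Qed.

Lemma weighted_sup_lin I (A : set I) (w : I -> R) (a : R[i]) (u v : I -> R[i]) :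
  (forall i, 0 <= w i) ->
  (ereal_sup [set (w i * normc (a * u i + v i))%:E | i in A] <=
   (normc a)%:E * ereal_sup [set (w i * normc (u i))%:E | i in A] +
   ereal_sup [set (w i * normc (v i))%:E | i in A])%E.
Proof.
move=> w0; apply: ge_ereal_sup => _ [i Ai <-].
have a0 : 0 <= normc a by case: (a) => x y; exact: sqrtr_ge0.
apply: (@le_trans _ _ ((normc a)%:E * (w i * normc (u i))%:E +
    (w i * normc (v i))%:E)%E).
  by rewrite -EFinM -EFinD lee_fin mulrCA -mulrDr ler_wpM2l// normc_lin.
apply: leeD; last by apply: ereal_sup_ubound; exists i.
by apply: lee_wpmul2l; [rewrite lee_fin|apply: ereal_sup_ubound; exists i].
Qed.

Lemma K1_norm_lin k (a : R[i]) f g : smooth f -> smooth g ->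
  (K1_norm k (a *: f + g)%R <= (normc a)%:E * K1_norm k f + K1_norm k g)%E.
Proof.
move=> sf sg; rewrite {1}/K1_norm.
under eq_imagel do rewrite mpartial_lin//.
by apply: weighted_sup_lin => p; exact: expR_ge0.
Qed.

Lemma KU_norm_lin k (a : R[i]) F G :
  (forall z, smooth (F ^~ z)) -> (forall z, smooth (G ^~ z)) ->
  (KU_norm k (a *: F + G)%R <= (normc a)%:E * KU_norm k F + KU_norm k G)%E.
Proof.
move=> sF sG; rewrite {1}/KU_norm.
under eq_imagel.
  move=> p _; rewrite (_ : (a *: F + G) ^~ p.1.2 =
    a *: (F ^~ p.1.2) + (G ^~ p.1.2))// mpartial_lin//.
  over.
by apply: weighted_sup_lin => p; rewrite mulr_ge0 ?expR_ge0 ?powR_ge0.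
Qed.

Lemma mpartial0 alpha : mpartial alpha (0 : 'rV[R]_n -> R[i]) = 0.
Proof.
have s0 : smooth (0 : 'rV[R]_n -> R[i]) by move=> r; exact: classC0.
have := mpartial_lin alpha (-1) s0 s0.
by rewrite scaleN1r oppr0 addr0 scaleN1r addNr.
Qed.

Lemma K1_norm0 k : (K1_norm k 0%R <= 0)%E.
Proof.
apply: ge_ereal_sup => _ [p _ <-].
by rewrite mpartial0 normc0 mulr0.
Qed.

Lemma KU_norm0 k : (KU_norm k 0%R <= 0)%E.
Proof.
apply: ge_ereal_sup => _ [p _ <-].
by rewrite mpartial0 normc0 mulr0.
Qed.

Lemma K1_submod_closed : submod_closed K1_pred.
Proof.
split.
  rewrite inE; split; first by move=> r; exact: classC0.
  by move=> k; exact: le_lt_trans (K1_norm0 k) _.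
move=> a f g; rewrite !inE => -[sf nf] [sg ng]; split.
  exact: smooth_lin.
move=> k; apply: le_lt_trans (K1_norm_lin k a sf sg) _.
apply: lte_add_pinfty; last exact: ng.
by apply: lte_mul_pinfty; rewrite ?lee_fin//; case: (a) => x y; exact: sqrtr_ge0.
Qed.

Lemma KU_submod_closed : submod_closed KU_pred.
Proof.
split.
  rewrite inE; split.
  - by move=> z r; exact: classC0.
  - by move=> x z; exact: differentiable_cst.
  - by move=> k; exact: le_lt_trans (KU_norm0 k) _.
move=> a F G; rewrite !inE => -[sF eF nF] [sG eG nG]; split.
- by move=> z; exact: smooth_lin.
- move=> x z; apply: differentiableD; last exact: eG.
  by apply: differentiableZ; exact: eF.
move=> k; apply: le_lt_trans (KU_norm_lin k a sF sG) _.
apply: lte_add_pinfty; last exact: nG.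
by apply: lte_mul_pinfty; rewrite ?lee_fin//; case: (a) => x y; exact: sqrtr_ge0.
Qed.

HB.instance Definition _ := GRing.isSubmodClosed.Build _ _ K1_pred
  K1_submod_closed.
HB.instance Definition _ := GRing.isSubmodClosed.Build _ _ KU_pred
  KU_submod_closed.

Record K1 := MkK1 { K1_fun :> 'rV[R]_n -> R[i] ; _ : K1_fun \in K1_pred }.
HB.instance Definition _ := [isSub for K1_fun].
HB.instance Definition _ := [Choice of K1 by <:].
HB.instance Definition _ := [SubChoice_isSubLmodule of K1 by <:].

Record KU := MkKU { KU_fun :> 'rV[R]_n -> 'rV[R[i]]_n -> R[i] ;
                    _ : KU_fun \in KU_pred }.
HB.instance Definition _ := [isSub for KU_fun].
HB.instance Definition _ := [Choice of KU by <:].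
HB.instance Definition _ := [SubChoice_isSubLmodule of KU by <:].

Let K1_seminorm (k : nat) (f : K1) : \bar R := K1_norm k f.
Let KU_seminorm (k : nat) (F : KU) : \bar R := KU_norm k F.

Let K1_smooth (f : K1) : smooth f.
Proof. by case: f => f /=; rewrite inE => -[]. Qed.

Let KU_smooth (F : KU) z : smooth (F ^~ z).
Proof. by case: F => F /=; rewrite inE => -[]. Qed.

Let K1_seminorm0 k : (K1_seminorm k 0%R <= 0)%E.
Proof. exact: K1_norm0. Qed.

Let KU_seminorm0 k : (KU_seminorm k 0%R <= 0)%E.
Proof. exact: KU_norm0. Qed.

Let K1_seminormD k f g :
  (K1_seminorm k (f + g)%R <= K1_seminorm k f + K1_seminorm k g)%E.
Proof.
have := K1_norm_lin k 1 (K1_smooth f) (K1_smooth g).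
by rewrite scale1r normc1 mul1e.
Qed.

Let KU_seminormD k F G :
  (KU_seminorm k (F + G)%R <= KU_seminorm k F + KU_seminorm k G)%E.
Proof.
have := KU_norm_lin k 1 (KU_smooth F) (KU_smooth G).
by rewrite scale1r normc1 mul1e.
Qed.

Let K1_seminormN k f : (K1_seminorm k (- f)%R <= K1_seminorm k f)%E.
Proof.
have := K1_norm_lin k (-1) (K1_smooth f) (K1_smooth 0).
rewrite scaleN1r normcN normc1 mul1e [(- _ + _)%R]addr0 => /le_trans; apply.
by rewrite -[leRHS]adde0; apply: leeD => //; exact: K1_norm0.
Qed.

Let KU_seminormN k F : (KU_seminorm k (- F)%R <= KU_seminorm k F)%E.
Proof.
have := KU_norm_lin k (-1) (KU_smooth F) (KU_smooth 0).
rewrite scaleN1r normcN normc1 mul1e [(- _ + _)%R]addr0 => /le_trans; apply.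
by rewrite -[leRHS]adde0; apply: leeD => //; exact: KU_norm0.
Qed.

HB.instance Definition _ := isUniform.Build K1
  (seminorm_entourage_filter K1_seminorm)
  (seminorm_entourage_diagonal K1_seminorm0)
  (seminorm_entourage_inv K1_seminormN)
  (seminorm_entourage_split K1_seminormD).

HB.instance Definition _ := isUniform.Build KU
  (seminorm_entourage_filter KU_seminorm)
  (seminorm_entourage_diagonal KU_seminorm0)
  (seminorm_entourage_inv KU_seminormN)
  (seminorm_entourage_split KU_seminormD).

End Spaces.

Section ShortTimeFourierTransform.
Variables (R : realType) (n : nat).

Definition cdot (z : 'rV[R[i]]_n) (t : 'rV[R]_n) : R[i] :=
  \sum_i z 0 i * (t 0 i)%:C.

Definition stft_integrand (psi phi : 'rV[R]_n -> R[i]) (x : 'rV[R]_n)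
    (z : 'rV[R[i]]_n) (t : 'rV[R]_n) : R[i] :=
  phi t * conjc (psi (t - x)) * cexp (- ((2 * pi)%:C * 'i%C * cdot z t)).

Definition stft (psi phi : 'rV[R]_n -> R[i]) (x : 'rV[R]_n)
    (z : 'rV[R[i]]_n) : R[i] :=
  cintegral (lebesgue_tuple R n)
    (fun s => stft_integrand psi phi x z (row_of_tuple s)).

Definition complex_row (xi : 'rV[R]_n) : 'rV[R[i]]_n :=
  map_mx (real_complex R) xi.

Definition adjoint_stft_integrand (psi : 'rV[R]_n -> R[i])
    (F : 'rV[R]_n -> 'rV[R[i]]_n -> R[i]) (t x xi : 'rV[R]_n) : R[i] :=
  F x (complex_row xi) * psi (t - x) *
  cexp ((2 * pi)%:C * 'i%C * cdot (complex_row xi) t).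

Definition adjoint_stft (psi : 'rV[R]_n -> R[i])
    (F : 'rV[R]_n -> 'rV[R[i]]_n -> R[i]) (t : 'rV[R]_n) : R[i] :=
  cintegral (lebesgue_tuple R n \x lebesgue_tuple R n)%E
    (fun s => adjoint_stft_integrand psi F t
                (row_of_tuple s.1) (row_of_tuple s.2)).

End ShortTimeFourierTransform.

(* Main.v *)
Require Import Defs.
From HB Require Import structures.
From mathcomp Require Import all_boot all_order all_algebra sesquilinear.
From mathcomp Require Import complex.
From mathcomp Require Import all_classical all_reals all_analysis measurable_realfun.
From mathcomp Require Import ring lra.

Set Implicit Arguments.
Unset Strict Implicit.
Unset Printing Implicit Defensive.

Import Order.TTheory GRing.Theory Num.Theory.
Import numFieldNormedType.Exports.
Import ComplexField.Normc.

Local Open Scope classical_set_scope.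
Local Open Scope ring_scope.

(** Both transforms are integrals of a product in which one factor carries all
    the dependence on the space variable, so everything reduces to estimates of
    integrals of exponentially decaying functions and to differentiation under
    the integral sign. By sesquilinearity, continuity follows from bounding each
    norm of the result by a constant times a product of norms of the arguments
    ([bilinear_estimate], [bilinear_continuous]).

    _The transform._ Differentiating [V_psi phi (x, z)] in [x] only replaces psi
    by a derivative of psi, up to sign ([is_cpartial_stft], [dword_stft]). The
    factor [exp (k |x|)] is split as [exp (k |t - x|) exp (k |t|)] between psi and
    phi, and phi also absorbs the growth [exp (2 pi k |t|)] of the kernel on the
    strip of width [k] ([stft_integrand_decays]). Decay in [z] comes from
    integration by parts: [2 pi i z_j V_psi phi] is the sum of the transforms in
    which [d_j] falls on phi and on psi ([stft_mulz]), and iterating this gives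
    the powers of [z_j] ([stft_power_bounded]). The boundary terms are avoided by
    translation invariance: a translated integral is constant in the translation,
    so the integral of a partial derivative vanishes ([cintegral_partial_eq0]).
    Holomorphy in [z] follows from the second-order Taylor estimate for the
    exponential, which gives a remainder quadratic in the increment
    ([normc_cexp_taylor], [stft_entire]).

    _The adjoint._ Here the integrand is bounded by
    [exp (- 2 |x|) (1 + |xi|) ^ (- 2 n)] times norms of Phi and psi. A derivative
    in [t] either falls on psi or multiplies Phi by [2 pi i xi_j]
    ([is_cpartial_synth]); decay in [x] and rapid decay in [xi] are stable under
    this multiplication, so induction on the order of derivation gives all norms
    ([synth_dword_bounded]).

    Two points need care. The norms of the space of test functions only involve
    partial derivatives taken in a fixed order of the variables, whereas the
    inductions above produce them in any order; the symmetry of mixed derivatives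
    ([schwarz], [perm_dword]) makes up for that. And elements of the second space
    are only separately regular in [x] and [z], so that joint measurability of
    the integrand of the adjoint comes from Caratheodory's argument
    ([measurable_fun_caratheodory]). *)

(** * Complex numbers and complex-valued integrals *)

Section ComplexNumbers.
Local Open Scope complex_scope.
Variable R : realType.
Implicit Types (a b z w : R[i]) (r : R).

Lemma ReD a b : complex.Re (a + b) = complex.Re a + complex.Re b.
Proof. by case: a b => ? ? []. Qed.

Lemma ImD a b : complex.Im (a + b) = complex.Im a + complex.Im b.
Proof. by case: a b => ? ? []. Qed.

Lemma ReN a : complex.Re (- a) = - complex.Re a.
Proof. by case: a. Qed.

Lemma ImN a : complex.Im (- a) = - complex.Im a.
Proof. by case: a. Qed.

Lemma ReM a b : complex.Re (a * b) =
  complex.Re a * complex.Re b - complex.Im a * complex.Im b.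
Proof. by case: a b => ? ? []. Qed.

Lemma ImM a b : complex.Im (a * b) =
  complex.Re a * complex.Im b + complex.Im a * complex.Re b.
Proof. by case: a b => ? ? [? ?] /=. Qed.

Lemma ReJ a : complex.Re (conjc a) = complex.Re a.
Proof. by case: a. Qed.

Lemma ImJ a : complex.Im (conjc a) = - complex.Im a.
Proof. by case: a. Qed.

Lemma Im_sum I (s : seq I) (F : I -> R[i]) :
  complex.Im (\sum_(i <- s) F i) = \sum_(i <- s) complex.Im (F i).
Proof. by elim/big_ind2 : _ => // ? ? ? ? <- <-; exact: ImD. Qed.

Lemma complex_ext a b :
  complex.Re a = complex.Re b -> complex.Im a = complex.Im b -> a = b.
Proof. by case: a b => ? ? [? ?] /= -> ->. Qed.

Lemma normc_ge0 z : 0 <= normc z.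
Proof. by case: z => x y; exact: sqrtr_ge0. Qed.

Lemma Re_le_normc z : `|complex.Re z| <= normc z.
Proof.
case: z => x y /=; rewrite -sqrtr_sqr ler_sqrt ?addr_ge0 ?sqr_ge0//.
by rewrite lerDl sqr_ge0.
Qed.

Lemma Im_le_normc z : `|complex.Im z| <= normc z.
Proof.
case: z => x y /=; rewrite -sqrtr_sqr ler_sqrt ?addr_ge0 ?sqr_ge0//.
by rewrite lerDr sqr_ge0.
Qed.

Lemma normc_real r : normc r%:C = `|r|.
Proof. by rewrite /= expr0n addr0 sqrtr_sqr. Qed.

Lemma normc_i : normc ('i%C : R[i]) = 1.
Proof. by rewrite /= expr0n add0r expr1n sqrtr1. Qed.

Lemma normc_le_ReIm z : normc z <= `|complex.Re z| + `|complex.Im z|.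
Proof.
case: z => x y /=; rewrite -[leRHS]ger0_norm ?addr_ge0// -sqrtr_sqr.
rewrite ler_sqrt ?sqr_ge0// sqrrD !real_normK ?num_real// lerD2r lerDl.
by rewrite mulrn_wge0// mulr_ge0.
Qed.

Lemma normcJ z : normc (conjc z) = normc z.
Proof. by case: z => x y /=; rewrite sqrrN. Qed.

Lemma normc_sum I (s : seq I) (F : I -> R[i]) :
  normc (\sum_(i <- s) F i) <= \sum_(i <- s) normc (F i).
Proof.
elim/big_ind2 : _ => [|a r b q ar bq|//]; first by rewrite normc0.
by rewrite (le_trans (le_normcD _ _))// lerD.
Qed.

Lemma cexp0 : cexp (0 : R[i]) = 1.
Proof. by rewrite /cexp /= expR0 cos0 sin0 mul1r. Qed.

Lemma cexpD z w : cexp (z + w) = cexp z * cexp w.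
Proof.
case: z w => [x y] [x' y']; rewrite /cexp /= expRD cosD sinD.
by apply: complex_ext => /=; ring.
Qed.

Lemma normc_cexp z : normc (cexp z) = expR (complex.Re z).
Proof.
rewrite /cexp normcM normc_real ger0_norm ?expR_ge0//=.
by rewrite cos2Dsin2 sqrtr1 mulr1.
Qed.

End ComplexNumbers.

Section ComplexIntegral.
Local Open Scope complex_scope.
Context d (T : measurableType d) (R : realType).
Variable mu : {measure set T -> \bar R}.
Implicit Types (f g : T -> R[i]) (M : T -> R) (c : R[i]).

Definition cmeasurable f :=
  measurable_fun setT (fun x => complex.Re (f x)) /\
  measurable_fun setT (fun x => complex.Im (f x)).

Lemma cmeasurable_cst c : cmeasurable (fun=> c).
Proof. by split. Qed.

Lemma cmeasurableD f g :
  cmeasurable f -> cmeasurable g -> cmeasurable (fun x => f x + g x).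
Proof.
move=> [fr fi] [gr gi]; split.
  by under eq_fun do rewrite ReD; exact: measurable_funD.
by under eq_fun do rewrite ImD; exact: measurable_funD.
Qed.

Lemma cmeasurableM f g :
  cmeasurable f -> cmeasurable g -> cmeasurable (fun x => f x * g x).
Proof.
move=> [fr fi] [gr gi]; split.
  by under eq_fun do rewrite ReM; apply: measurable_funB; exact: measurable_funM.
by under eq_fun do rewrite ImM; apply: measurable_funD; exact: measurable_funM.
Qed.

Lemma cmeasurable_sum I (s : seq I) (F : I -> T -> R[i]) :
  (forall i, cmeasurable (F i)) -> cmeasurable (fun x => \sum_(i <- s) F i x).
Proof.
move=> mF; elim: s => [|i s IHs].
  by under eq_fun do rewrite big_nil; exact: cmeasurable_cst.
by under eq_fun do rewrite big_cons; exact: cmeasurableD.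
Qed.

Lemma cmeasurable_conj f : cmeasurable f -> cmeasurable (fun x => conjc (f x)).
Proof.
move=> [fr fi]; split; first by under eq_fun do rewrite ReJ.
by under eq_fun do rewrite ImJ; exact: measurableT_comp.
Qed.

Lemma cmeasurable_real M :
  measurable_fun setT M -> cmeasurable (fun x => (M x)%:C).
Proof. by split. Qed.

Lemma cmeasurable_cexp f : cmeasurable f -> cmeasurable (fun x => cexp (f x)).
Proof.
move=> [fr fi]; split; rewrite /cexp/=.
  under eq_fun do rewrite mul0r subr0.
  apply: measurable_funM; first exact: measurableT_comp.
  apply: measurableT_comp => //; apply: continuous_measurable_fun.
  exact: continuous_cos.
under eq_fun do rewrite mul0r addr0.
apply: measurable_funM; first exact: measurableT_comp.
apply: measurableT_comp => //; apply: continuous_measurable_fun.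
exact: continuous_sin.
Qed.

Lemma le_cintegrable f M : cmeasurable f -> mu.-integrable setT (EFin \o M) ->
  (forall x, normc (f x) <= M x) -> cintegrable mu f.
Proof.
move=> [fr fi] iM fM; split; apply: le_integrable iM => //.
- exact/measurable_EFinP.
- move=> x _ /=; rewrite lee_fin (le_trans (Re_le_normc _))//.
  by rewrite (le_trans (fM x))// ler_norm.
- exact/measurable_EFinP.
- move=> x _ /=; rewrite lee_fin (le_trans (Im_le_normc _))//.
  by rewrite (le_trans (fM x))// ler_norm.
Qed.

(** Bounding real and imaginary parts separately costs the factor 2. *)
Lemma le_normc_cintegral f M : cmeasurable f ->
  mu.-integrable setT (EFin \o M) -> (forall x, normc (f x) <= M x) ->
  normc (cintegral mu f) <= 2 * \int[mu]_x M x.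
Proof.
move=> mf iM fM; have [ir ii] := le_cintegrable mf iM fM.
have aux (g : T -> R) : mu.-integrable setT (EFin \o g) ->
    (forall x, `|g x| <= normc (f x)) -> `|\int[mu]_x g x| <= \int[mu]_x M x.
  move=> ig gf; apply: le_trans (le_normr_Rintegral _ ig) _ => //.
  apply: le_Rintegral => //; first exact: integrable_norm.
  by move=> x _; exact: le_trans (fM x).
apply: le_trans (normc_le_ReIm _) _; rewrite /cintegral /= mulr_natl mulr2n.
by apply: lerD; apply: aux => // x; [exact: Re_le_normc|exact: Im_le_normc].
Qed.

Lemma cintegrableD f g : cintegrable mu f -> cintegrable mu g ->
  cintegrable mu (fun x => f x + g x).
Proof.
move=> [fr fi] [gr gi]; split.
  by under eq_fun do rewrite ReD EFinD; exact: integrableD.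
by under eq_fun do rewrite ImD EFinD; exact: integrableD.
Qed.

Lemma cintegralD f g : cintegrable mu f -> cintegrable mu g ->
  cintegral mu (fun x => f x + g x) = cintegral mu f + cintegral mu g.
Proof.
move=> [fr fi] [gr gi]; apply: complex_ext; rewrite /cintegral ?ReD ?ImD /=.
  by under eq_Rintegral do rewrite ReD; rewrite RintegralD.
by under eq_Rintegral do rewrite ImD; rewrite RintegralD.
Qed.

Lemma cintegrableZ c f : cintegrable mu f -> cintegrable mu (fun x => c * f x).
Proof.
move=> [fr fi]; split.
  under eq_fun do rewrite ReM EFinB !EFinM.
  by apply: integrableB => //; exact: integrableZl.
under eq_fun do rewrite ImM EFinD !EFinM.
by apply: integrableD => //; exact: integrableZl.
Qed.

Lemma cintegralZ c f : cintegrable mu f ->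
  cintegral mu (fun x => c * f x) = c * cintegral mu f.
Proof.
move=> [fr fi].
have Z k (g : T -> R) : mu.-integrable setT (EFin \o g) ->
    mu.-integrable setT (EFin \o (fun x => k * g x)).
  by move=> ig; under [_ \o _]eq_fun do rewrite /= EFinM; exact: integrableZl.
apply: complex_ext; rewrite /cintegral ?ReM ?ImM /=.
  under eq_Rintegral do rewrite ReM.
  by rewrite RintegralB ?RintegralZl//; exact: Z.
under eq_Rintegral do rewrite ImM.
by rewrite RintegralD ?RintegralZl//; exact: Z.
Qed.

Lemma cintegrableN f : cintegrable mu f -> cintegrable mu (fun x => - f x).
Proof.
by move=> /(cintegrableZ (-1)); under eq_fun do rewrite mulN1r.
Qed.

Lemma cintegralN f : cintegrable mu f ->
  cintegral mu (fun x => - f x) = - cintegral mu f.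
Proof.
by move=> /(cintegralZ (-1)); under eq_fun do rewrite mulN1r; rewrite mulN1r.
Qed.

End ComplexIntegral.

(** * Measurability of Caratheodory functions on R^n *)

Section Caratheodory.
Context d (T : measurableType d) (R : realType) (n : nat).

Let grid_point (m : nat) (v : {ffun 'I_n -> int}) : 'rV[R]_n :=
  \row_i ((v i)%:~R / m.+1%:R).

Let cell (m : nat) (s : Rtuple R n) : {ffun 'I_n -> int} :=
  [ffun i => Num.floor (m.+1%:R * tnth s i : R)].

Let grid_cvg (s : Rtuple R n) :
  grid_point m (cell m s) @[m --> \oo] --> row_of_tuple s.
Proof.
apply/cvg_ballP => e e0; have := near_infty_natSinv_lt (PosNum e0).
apply: filterS => m /= me; split => // i j.
rewrite !mxE /ball/= /cell ffunE; set x : R := tnth s j.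
have m0 : (0 < m.+1%:R :> R) by rewrite ltr0n.
have /andP[fl fu] := floor_itv (m.+1%:R * x : R).
have -> : x - (Num.floor (m.+1%:R * x))%:~R / m.+1%:R =
  (m.+1%:R * x - (Num.floor (m.+1%:R * x))%:~R) * m.+1%:R^-1.
  by field; rewrite ?pnatr_eq0// gt_eqF.
rewrite normrM [X in _ * X]ger0_norm ?invr_ge0 ?ltW//.
apply: le_lt_trans me; apply: ler_piMl; first by rewrite invr_ge0 ltW.
rewrite ler_norml.
by move: fu; rewrite intrD; lra.
Qed.

Let measurable_cell m v : measurable [set s | cell m s = v].
Proof.
have -> : [set s | cell m s = v] = \bigcap_(i in [set: 'I_n])
    ((fun s : Rtuple R n => tnth s i) @^-1`
      `[(v i)%:~R / m.+1%:R, ((v i + 1)%:~R / m.+1%:R : R)[).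
  apply/seteqP; split => s /=.
    move=> <- i _ /=; rewrite in_itv/= ffunE.
    by rewrite ler_pdivrMr ?ltr0n// ltr_pdivlMr ?ltr0n// mulrC floor_itv.
  move=> sv; apply/ffunP => i; have := sv i I; rewrite /= in_itv/= ffunE.
  rewrite ler_pdivrMr ?ltr0n// ltr_pdivlMr ?ltr0n// mulrC => ?.
  exact: floor_def.
apply: fin_bigcap_measurable => // i _.
by rewrite -[X in measurable X]setTI; exact: measurable_tnth.
Qed.

(** Caratheodory's argument: such an f is the pointwise limit of
    [f (grid point nearest to x) y], and these functions of (x, y) are
    measurable because the grid is countable. *)
Lemma measurable_fun_caratheodory (f : 'rV[R]_n -> T -> R) :
  (forall y, continuous (f ^~ y)) -> (forall x, measurable_fun setT (f x)) ->
  measurable_fun setT (fun p : Rtuple R n * T => f (row_of_tuple p.1) p.2).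
Proof.
move=> cf mf.
apply: (@measurable_fun_cvg _ _ _ _
  (fun m p => f (grid_point m (cell m p.1)) p.2)) => [m|[s y] _ /=]; last first.
  exact: (cvg_comp _ (f ^~ y) (@grid_cvg s) (cf y (row_of_tuple s))).
move=> _ Y mY; rewrite setTI.
have -> : (fun p : Rtuple R n * T => f (grid_point m (cell m p.1)) p.2) @^-1` Y
    = \bigcup_v ([set s | cell m s = v] `*` (f (grid_point m v) @^-1` Y)).
  apply/seteqP; split => [[s y] /= Yf|[s y] /= [v _ [/= <-]]]//.
  by exists (cell m s).
apply: countable_bigcupT_measurable; first exact: countableP.
move=> v; apply: measurableX; first exact: measurable_cell.
by rewrite -[X in measurable X]setTI; exact: mf.
Qed.


End Caratheodory.

Lemma continuous_measurable_row (R : realType) (n : nat) (f : 'rV[R]_n -> R) :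
  continuous f -> measurable_fun setT (fun s : Rtuple R n => f (row_of_tuple s)).
Proof.
move=> cf.
have mf := @measurable_fun_caratheodory _ unit R n (fun x _ => f x)
  (fun=> cf) (fun=> measurable_cst _).
exact: (measurableT_comp mf (@pair2_measurable _ _ (Rtuple R n) unit tt)).
Qed.

(** * Lebesgue measure on R^n: translations and an integrable weight *)

Section LebesgueTuple.
Variable R : realType.
Local Notation leb := (@lebesgue_measure R).
Local Notation mu n := (lebesgue_tuple R n).

Lemma ge0_integral_lebesgue_tupleS n (f : Rtuple R n.+1 -> \bar R) :
  measurable_fun setT f -> (forall s, 0 <= f s)%E ->
  (\int[mu n.+1]_s f s =
   \int[leb]_a \int[mu n]_s f (cons_pair (a, s)))%E.
Proof.
move=> mf f0.
rewrite /= /lebesgue_step ge0_integral_pushforward//; last first.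
  exact: measurable_cons_pair.
rewrite preimage_setT (fubini_tonelli1 (f \o @cons_pair R n))//.
- by apply: measurableT_comp => //; exact: measurable_cons_pair.
- by move=> p; exact: f0.
Qed.

Let translate (c : R) (x : measurableTypeR R) : measurableTypeR R := (x : R) + c.

Lemma lebesgue_measure_translate (c : R) (A : set (measurableTypeR R)) :
  measurable A -> leb A = pushforward leb (translate c) A.
Proof.
move=> mA.
have mphi : measurable_fun setT (translate c).
  exact: measurable_funD.
pose phi : {mfun measurableTypeR R >-> measurableTypeR R} :=
  HB.pack (translate c) (isMeasurableFun.Build _ _ _ _ _ mphi).
apply: (@lebesgue_measure_unique R (pushforward leb phi)) => // _ [[a b] _ <-].
rewrite /pushforward.
rewrite [X in _ = leb X](_ : _ = `]a - c, b - c]%classic); last first.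
  by apply/seteqP; split => x /=; rewrite !in_itv/= /phi/= ltrBlDr lerBrDr.
rewrite !lebesgue_measure_itv/= !lte_fin ltrD2r.
by case: ifPn => // _; rewrite -!EFinB; congr EFin; ring.
Qed.

Lemma ge0_integral_translate (c : R) (f : measurableTypeR R -> \bar R) :
  measurable_fun setT f -> (forall s, 0 <= f s)%E ->
  (\int[leb]_a f ((a : R) + c)%R = \int[leb]_a f a)%E.
Proof.
move=> mf f0.
have mphi : measurable_fun setT (translate c).
  exact: measurable_funD.
have <- : (\int[pushforward leb (translate c)]_a f a = \int[leb]_a f a)%E.
  apply: eq_measure_integral => A mA _; exact/esym/lebesgue_measure_translate.
by rewrite ge0_integral_pushforward.
Qed.



Definition shift_tuple n (v : 'I_n -> R) (s : Rtuple R n) : Rtuple R n :=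
  [tuple (tnth s i : R) + v i | i < n].

Lemma measurable_shift_tuple n (v : 'I_n -> R) :
  measurable_fun setT (shift_tuple v).
Proof.
apply/measurable_fun_tnthP => i; rewrite /comp.
under eq_fun do rewrite tnth_mktuple.
by apply: measurable_funD => //; exact: measurable_tnth.
Qed.

Lemma shift_cons_pair n (v : 'I_n.+1 -> R) (a : R) (s : Rtuple R n) :
  shift_tuple v (cons_pair (a, s)) =
  cons_pair ((a + v ord0 : measurableTypeR R), shift_tuple (v \o lift ord0) s).
Proof.
apply: eq_from_tnth => i; rewrite tnth_mktuple.
by case: (unliftP ord0 i) => [j ->|->]; rewrite ?tnthS ?tnth_mktuple.
Qed.

Lemma ge0_integral_shift_tuple n (v : 'I_n -> R) (f : Rtuple R n -> \bar R) :
  measurable_fun setT f -> (forall s, 0 <= f s)%E ->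
  (\int[mu n]_s f (shift_tuple v s) = \int[mu n]_s f s)%E.
Proof.
elim: n v f => [|n IHn] v f mf f0.
  by apply: eq_integral => s _; rewrite (tuple0 s) (tuple0 (shift_tuple _ _)).
have mfp : measurable_fun setT (f \o @cons_pair R n).
  by apply: measurableT_comp => //; exact: measurable_cons_pair.
rewrite !ge0_integral_lebesgue_tupleS//; last first.
  by apply: measurableT_comp => //; exact: measurable_shift_tuple.
rewrite -[RHS](ge0_integral_translate (v ord0)); last 2 first.
- exact: (measurable_fun_fubini_tonelli_F (m2 := mu n) _ mfp (fun=> f0 _)).
- by move=> a; apply: integral_ge0.
apply: eq_integral => a _ /=.
under eq_integral do rewrite shift_cons_pair.
rewrite (IHn _ (fun s => f (cons_pair ((a : R) + v ord0, s))))//.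
exact: (measurableT_comp mfp (@pair1_measurable _ _ (measurableTypeR R)
  (Rtuple R n) ((a : R) + v ord0))).
Qed.

Lemma integral_shift_tuple n (v : 'I_n -> R) (f : Rtuple R n -> \bar R) :
  measurable_fun setT f ->
  (\int[mu n]_s f (shift_tuple v s) = \int[mu n]_s f s)%E.
Proof.
move=> mf; rewrite integralE [RHS]integralE.
have shiftP := ge0_integral_shift_tuple v (measurable_funepos mf)
  (fun s => funepos_ge0 f s).
have shiftN := ge0_integral_shift_tuple v (measurable_funeneg mf)
  (fun s => funeneg_ge0 f s).
rewrite -shiftP -shiftN; congr (_ - _)%E.
  by apply: eq_integral => s _; rewrite !funeposE.
by apply: eq_integral => s _; rewrite !funenegE.
Qed.

Lemma row_of_shift_tuple n (v : 'rV[R]_n) (s : Rtuple R n) :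
  row_of_tuple (shift_tuple (v 0) s) = row_of_tuple s + v.
Proof. by apply/rowP => i; rewrite !mxE tnth_mktuple. Qed.

Lemma cintegral_translate n (v : 'rV[R]_n) (f : 'rV[R]_n -> R[i]) :
  cmeasurable (fun s : Rtuple R n => f (row_of_tuple s)) ->
  cintegral (mu n) (fun s => f (row_of_tuple s + v)) =
  cintegral (mu n) (fun s => f (row_of_tuple s)).
Proof.
move=> [mr mi]; apply: complex_ext; rewrite /= /Rintegral; congr fine.
  under eq_integral do rewrite -row_of_shift_tuple.
  rewrite (integral_shift_tuple (v 0)
    (f := fun s => (complex.Re (f (row_of_tuple s)))%:E))//.
  exact/measurable_EFinP.
under eq_integral do rewrite -row_of_shift_tuple.
rewrite (integral_shift_tuple (v 0)
  (f := fun s => (complex.Im (f (row_of_tuple s)))%:E))//.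
exact/measurable_EFinP.
Qed.

(** The common majorant of all integrands: it dominates both the exponential
    decay in space and the polynomial decay in frequency, and its integral
    factors over the coordinates. *)
Definition rational_weight n (t : 'rV[R]_n) : R := \prod_i (oneDsqr (t 0 i))^-1.

Lemma rational_weight_ge0 n (t : 'rV[R]_n) : 0 <= rational_weight t.
Proof. by apply: prodr_ge0 => i _; rewrite invr_ge0 (le_trans ler01). Qed.

Lemma measurable_rational_weight n :
  measurable_fun setT (fun s : Rtuple R n => rational_weight (row_of_tuple s)).
Proof.
apply: measurable_prod => i _.
under eq_fun do rewrite mxE.
apply: (measurableT_comp (f := fun x : R => (oneDsqr x)^-1)); last first.
  exact: measurable_tnth.
by apply: continuous_measurable_fun; exact: continuous_oneDsqrV.
Qed.

Let rational_weight_integralZ n (c : R) : 0 <= c ->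
  (\int[mu n]_s (c * rational_weight (row_of_tuple s))%:E =
   c%:E * \int[mu n]_s (rational_weight (row_of_tuple s))%:E)%E.
Proof.
move=> c0; under eq_integral do rewrite EFinM.
rewrite ge0_integralZl//.
- by apply/measurable_EFinP; exact: measurable_rational_weight.
- by move=> s _; rewrite lee_fin rational_weight_ge0.
Qed.

Lemma rational_weight_integral n :
  (\int[mu n]_s (rational_weight (row_of_tuple s))%:E = (pi ^+ n)%:E)%E.
Proof.
elim: n => [|n IHn].
  rewrite integral_dirac//; last first.
    by apply/measurable_EFinP; exact: measurable_rational_weight.
  by rewrite diracE in_setT mul1e /rational_weight big_ord0.
rewrite (@ge0_integral_lebesgue_tupleS _
  (fun s => (rational_weight (row_of_tuple s))%:E)); last 2 first.
- by apply/measurable_EFinP; exact: measurable_rational_weight.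
- by move=> s; rewrite lee_fin rational_weight_ge0.
have om_cons (a : R) (s : Rtuple R n) :
    rational_weight (row_of_tuple (cons_pair (a : measurableTypeR R, s))) =
    (oneDsqr a)^-1 * rational_weight (row_of_tuple s).
  rewrite /rational_weight big_ord_recl mxE; congr (_ * _).
  by apply: eq_bigr => i _; rewrite !mxE tnthS.
under eq_integral => a _.
  under eq_integral do rewrite om_cons.
  rewrite rational_weight_integralZ ?invr_ge0 ?(le_trans ler01)// IHn.
  over.
rewrite /= ge0_integralZr//; last 2 first.
- apply/measurable_EFinP; apply: continuous_measurable_fun.
  exact: continuous_oneDsqrV.
- by rewrite lee_fin exprn_ge0// pi_ge0.
rewrite (@ge0_symfun_integralT _ (fun a => (oneDsqr a)^-1)); last 3 first.
- by move=> a; rewrite invr_ge0 (le_trans ler01).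
- exact: continuous_oneDsqrV.
- by move=> a /=; rewrite /oneDsqr sqrrN.
rewrite -set_itvcy integral0y_oneDsqr -!EFinM exprS; congr EFin.
by field.
Qed.

Lemma integrable_rational_weight n :
  (mu n).-integrable setT (fun s => (rational_weight (row_of_tuple s))%:E).
Proof.
apply/integrableP; split.
  by apply/measurable_EFinP; exact: measurable_rational_weight.
under eq_integral do rewrite gee0_abs ?lee_fin ?rational_weight_ge0//.
by rewrite rational_weight_integral ltry.
Qed.

Lemma integrable_rational_weight_prod n :
  (mu n \x mu n)%E.-integrable setT (fun p : Rtuple R n * Rtuple R n =>
    (rational_weight (row_of_tuple p.1) * rational_weight (row_of_tuple p.2))%:E).
Proof.
have mw : measurable_fun setT (fun p : Rtuple R n * Rtuple R n =>
    (rational_weight (row_of_tuple p.1) *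
     rational_weight (row_of_tuple p.2))%:E).
  apply/measurable_EFinP; apply: measurable_funM.
    exact: (measurableT_comp (@measurable_rational_weight n) measurable_fst).
  exact: (measurableT_comp (@measurable_rational_weight n) measurable_snd).
apply/integrable12ltyP => //=.
under eq_integral => x _.
  under eq_integral do rewrite ger0_norm ?mulr_ge0 ?rational_weight_ge0//.
  rewrite rational_weight_integralZ ?rational_weight_ge0//.
  rewrite rational_weight_integral.
  over.
rewrite ge0_integralZr//; last 3 first.
- by apply/measurable_EFinP; exact: measurable_rational_weight.
- by move=> s _; rewrite lee_fin rational_weight_ge0.
- by rewrite lee_fin exprn_ge0// pi_ge0.
by rewrite rational_weight_integral -EFinM ltry.
Qed.

End LebesgueTuple.

(** * Directional derivatives *)

Section DirectionalDerivative.
Variables (R : realType) (V : normedModType R).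
Implicit Types (f : V -> R) (x u v : V).

Lemma is_derive_line f x v (h d : R) :
  is_derive h 1 (fun s : R => f (x + s *: v)) d <->
  is_derive (x + h *: v) v f d.
Proof.
have quotE : (fun s : R => s^-1 *: ((fun s : R => f (x + s *: v)) (s *: 1 + h) -
      (fun s : R => f (x + s *: v)) h)) =
    (fun s : R => s^-1 *: (f (s *: v + (x + h *: v)) - f (x + h *: v))).
  apply/funext => s /=; congr (_ *: (f _ - _)).
  by rewrite scaler1 scalerDl addrCA.
split => -[dv de]; apply: DeriveDef.
- by move: dv; rewrite /derivable quotE.
- by move: de; rewrite /derive quotE.
- by rewrite /derivable quotE.
- by rewrite /derive quotE.
Qed.

Lemma is_derive_line0 f x v (d : R) :
  is_derive (0 : R) 1 (fun s : R => f (x + s *: v)) d <-> is_derive x v f d.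
Proof. by rewrite is_derive_line scale0r addr0. Qed.

(** The intermediate point is only located up to sign, so that both signs of h
    are covered. *)
Lemma directional_MVT f x v (h : R) :
  (forall y, derivable f y v) ->
  exists2 c : R, `|c| <= `|h| &
    f (x + h *: v) - f x = h * 'D_v f (x + c *: v).
Proof.
move=> df.
have dg (s : R) : is_derive s 1 (fun s : R => f (x + s *: v)) ('D_v f (x + s *: v)).
  by apply/is_derive_line; exact: derivableP.
have cg : continuous (fun s : R => f (x + s *: v)).
  by move=> s; apply: differentiable_continuous; apply/derivable1_diffP; exact: ex_derive.
have [h0|h0] := leP 0 h.
  have [c] := MVT_segment h0 (fun s _ => dg s) (continuous_subspaceT cg).
  rewrite in_itv/= => /andP[c0 ch]; rewrite scale0r addr0 subr0 => ->.
  by exists c; [rewrite !ger0_norm|rewrite mulrC].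
have [c] := MVT_segment (ltW h0) (fun s _ => dg s) (continuous_subspaceT cg).
rewrite in_itv/= => /andP[ch c0]; rewrite scale0r addr0 sub0r => E.
exists c; first by rewrite !ler0_norm ?lerN2// ltW.
by rewrite -opprB E mulrN opprK mulrC.
Qed.

(** Second difference quotients of f along u and v can be computed in either
    order, so each of them is a value of both mixed derivatives near x. *)
Lemma schwarz f x u v :
  (forall y, derivable f y u) -> (forall y, derivable f y v) ->
  (forall y, derivable ('D_u f) y v) -> (forall y, derivable ('D_v f) y u) ->
  {for x, continuous ('D_v ('D_u f))} -> {for x, continuous ('D_u ('D_v f))} ->
  'D_v ('D_u f) x = 'D_u ('D_v f) x.
Proof.
have second_difference g (a b : V) (s : R) :
    (forall y, derivable g y a) -> (forall y, derivable ('D_a g) y b) ->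
    exists c c' : R, [/\ `|c| <= `|s|, `|c'| <= `|s| &
    g (x + s *: a + s *: b) - g (x + s *: a) - (g (x + s *: b) - g x) =
    s * (s * 'D_b ('D_a g) (x + (c *: a + c' *: b)))].
  move=> da dab.
  pose k y := g (y + s *: b) - g y.
  have dk y : is_derive y a k ('D_a g (y + s *: b) - 'D_a g y).
    apply: is_deriveB; last exact: derivableP.
    have := derivableP (da (y + s *: b)) => /is_derive_line0 dg.
    apply/is_derive_line0; move: dg; congr is_derive.
    by apply/funext => r; rewrite addrAC.
  have [c cs kc] := @directional_MVT k x a s (fun y => @ex_derive _ _ _ _ _ _ _ (dk y)).
  have [c' c's kc'] := @directional_MVT ('D_a g) (x + c *: a) b s dab.
  exists c, c'; split => //.
  have -> : g (x + s *: a + s *: b) - g (x + s *: a) - (g (x + s *: b) - g x) =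
    k (x + s *: a) - k x by [].
  by rewrite kc (@derive_val _ _ _ _ _ _ _ (dk _)) kc' addrA.
move=> du dv duv dvu cuv cvu; apply: contrapT => /eqP neq.
pose e := `|'D_v ('D_u f) x - 'D_u ('D_v f) x| / 2.
have e0 : 0 < e by rewrite divr_gt0// normr_gt0 subr_eq0.
have /cvgrPdist_lt/(_ _ e0)/nbhs_ballP[r /= r0 ruv] := cuv.
have /cvgrPdist_lt/(_ _ e0)/nbhs_ballP[r' /= r'0 rvu] := cvu.
pose m := Num.min r r' / (`|u| + `|v| + 1).
have w0 : 0 < `|u| + `|v| + 1 by rewrite ltr_wpDl// addr_ge0.
have m0 : 0 < m by rewrite divr_gt0// lt_min r0.
(* Any s with 0 < s < m puts all intermediate points in the two balls. *)
pose s := m / 2; have s0 : 0 < s by rewrite divr_gt0.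
have near_x (c c' : R) a b : `|a| + `|b| = `|u| + `|v| -> `|c| <= `|s| ->
    `|c'| <= `|s| -> `|x - (x + (c *: a + c' *: b))| < Num.min r r'.
  move=> ab cs c's; rewrite opprD addrA subrr add0r normrN.
  apply: le_lt_trans (ler_normD _ _) _; rewrite !normrZ.
  apply: (@le_lt_trans _ _ (s * (`|a| + `|b|))).
    rewrite mulrDr lerD// ler_wpM2r//.
    by rewrite (le_trans cs)// ger0_norm// ltW.
    by rewrite (le_trans c's)// ger0_norm// ltW.
  rewrite ab -[ltRHS](@divfK _ (`|u| + `|v| + 1)) ?gt_eqF// -/m.
  apply: ltr_pM; [exact: ltW|exact: addr_ge0| |].
    by rewrite /s ltr_pdivrMr// mulrDr !mulr1 ltrDl.
  by rewrite ltrDl ltr01.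
have [c [c' [cs c's E1]]] := second_difference f u v s du duv.
have [d [d' [ds d's E2]]] := second_difference f v u s dv dvu.
have E : 'D_v ('D_u f) (x + (c *: u + c' *: v)) =
         'D_u ('D_v f) (x + (d *: v + d' *: u)).
  have sn0 : s != 0 by rewrite gt_eqF.
  apply: (mulfI sn0); apply: (mulfI sn0).
  apply: etrans (esym E1) (etrans _ E2).
  rewrite (addrAC x (s *: v)).
  by move: (f (x + _)) (f (x + s *: u)) (f (x + _)) => *; ring.
have A1 : `|'D_u ('D_v f) x - 'D_u ('D_v f) (x + (d *: v + d' *: u))| < e.
  apply: rvu; rewrite -ball_normE; apply: lt_le_trans (near_x _ _ _ _ _ ds d's) _.
    by rewrite addrC.
  by rewrite ge_min lexx orbT.
have A2 : `|'D_v ('D_u f) x - 'D_v ('D_u f) (x + (c *: u + c' *: v))| < e.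
  apply: ruv; rewrite -ball_normE; apply: lt_le_trans (near_x _ _ _ _ _ cs c's) _.
    by [].
  by rewrite ge_min lexx.
have : `|'D_v ('D_u f) x - 'D_u ('D_v f) x| < e + e.
  rewrite -(subrK ('D_v ('D_u f) (x + (c *: u + c' *: v))) ('D_v ('D_u f) x)).
  rewrite -addrA; apply: le_lt_trans (ler_normD _ _) _.
  by apply: ltrD A2 _; rewrite E distrC.
by rewrite /e -splitr ltxx.
Qed.

End DirectionalDerivative.

(** * Partial derivatives of complex-valued functions *)

Section ComplexTopology.
Variable R : realType.

Lemma normr_normc (z : R[i]) : `|z| = (normc z)%:C%C.
Proof. by []. Qed.

Lemma pos_complexE (e : R[i]) : 0 < e -> exists2 r : R, 0 < r & e = (r%:C)%C.
Proof.
case: e => a b; rewrite ltcE/= => /andP[/eqP -> a0]; by exists a.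
Qed.

Lemma cvg_Re T (F : set_system T) {FF : Filter F} (f : T -> R[i]) (l : R[i]) :
  f x @[x --> F] --> l -> complex.Re (f x) @[x --> F] --> complex.Re l.
Proof.
move=> /cvgrPdist_lt fl; apply/cvgrPdist_lt => e e0.
have /fl : 0 < (e%:C)%C by rewrite ltcR.
apply: filterS => x; rewrite normr_normc ltcR; apply: le_lt_trans.
by rewrite -ReN -ReD Re_le_normc.
Qed.

Lemma cvg_Im T (F : set_system T) {FF : Filter F} (f : T -> R[i]) (l : R[i]) :
  f x @[x --> F] --> l -> complex.Im (f x) @[x --> F] --> complex.Im l.
Proof.
move=> /cvgrPdist_lt fl; apply/cvgrPdist_lt => e e0.
have /fl : 0 < (e%:C)%C by rewrite ltcR.
apply: filterS => x; rewrite normr_normc ltcR; apply: le_lt_trans.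
by rewrite -ImN -ImD Im_le_normc.
Qed.

Lemma continuous_ReIm (T : topologicalType) (f : T -> R[i]) :
  continuous (fun x => complex.Re (f x)) ->
  continuous (fun x => complex.Im (f x)) -> continuous f.
Proof.
move=> cr ci x; apply/cvgrPdist_lt => e /pos_complexE[r r0 ->].
have r20 : 0 < r / 2 by rewrite divr_gt0.
have hr : \forall y \near x, `|complex.Re (f x) - complex.Re (f y)| < r / 2.
  by move/cvgrPdist_lt : (cr x); exact.
have hi : \forall y \near x, `|complex.Im (f x) - complex.Im (f y)| < r / 2.
  by move/cvgrPdist_lt : (ci x); exact.
near=> y; rewrite normr_normc ltcR; apply: le_lt_trans (normc_le_ReIm _) _.
rewrite [ltRHS]splitr ReD ReN ImD ImN; apply: ltrD.
  by near: y.
by near: y.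
Unshelve. all: by end_near. Qed.

End ComplexTopology.

Lemma lipschitz_continuous (R : realType) (V : normedModType R) (f : V -> R)
    (L : R) :
  (forall x y, `|f x - f y| <= L * `|x - y|) -> continuous f.
Proof.
move=> fL x; apply/cvgrPdist_lt => e e0.
have L0 : 0 < `|L| + 1 by rewrite ltr_wpDl.
have eL : 0 < e / (`|L| + 1) by rewrite divr_gt0.
have := nbhsx_ballx x _ eL; apply: filterS => y; rewrite -ball_normE /ball_/=.
rewrite ltr_pdivlMr// mulrC; apply: le_lt_trans; apply: le_trans (fL _ _) _.
by rewrite ler_wpM2r// (le_trans (ler_norm _))// lerDl.
Qed.

Section Rows.
Variables (R : realType) (n : nat).
Implicit Types (x y : 'rV[R]_n).

Definition l1norm x : R := \sum_i `|x 0 i|.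

Lemma l1norm_ge0 x : 0 <= l1norm x.
Proof. exact: sumr_ge0. Qed.

Lemma entry_le_l1norm x i : `|x 0 i| <= l1norm x.
Proof. by rewrite /l1norm (bigD1 i)//= lerDl sumr_ge0. Qed.

Lemma l1normD x y : l1norm (x + y) <= l1norm x + l1norm y.
Proof.
by rewrite /l1norm -big_split; apply: ler_sum => i _; rewrite mxE ler_normD.
Qed.

Lemma l1normN x : l1norm (- x) = l1norm x.
Proof. by apply: eq_bigr => i _; rewrite mxE normrN. Qed.

Lemma l1norm_delta (h : R) i : l1norm (h *: 'e_i) = `|h|.
Proof.
rewrite /l1norm (bigD1 i)//= big1 ?addr0 => [|j ji].
  by rewrite !mxE !eqxx mulr1.
by rewrite !mxE (negbTE ji) andbF mulr0 normr0.
Qed.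

(** Change one coordinate at a time and apply the mean value theorem to each
    change. *)
Lemma bounded_partials_lipschitz (f : 'rV[R]_n -> R) (M : R) :
  (forall i x, derivable f x 'e_i) -> (forall i x, `|'D_'e_i f x| <= M) ->
  forall x y, `|f y - f x| <= M * l1norm (y - x).
Proof.
move=> df fM x y.
pose p k : 'rV[R]_n := \row_(i < n) (if (i < k)%N then y 0 i else x 0 i).
have -> : y = p n by apply/rowP => i; rewrite mxE ltn_ord.
have {1}-> : x = p 0%N by apply/rowP => i; rewrite mxE ltn0.
rewrite -(telescope_sumr (f \o p)) // big_mkord.
apply: le_trans (ler_norm_sum _ _ _) _; rewrite /l1norm mulr_sumr.
apply: ler_sum => i _ /=.
have -> : p i.+1 = p i + (y 0 i - x 0 i) *: 'e_i.
  apply/rowP => j; rewrite !mxE ltnS leq_eqVlt eqxx/= eq_sym.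
  have [->|ij] := eqVneq i j; first by rewrite eqxx ltnn/= mulr1 addrCA subrr addr0.
  by rewrite val_eqE (negbTE ij)/= mulr0 addr0.
have [c _ ->] := directional_MVT (p i) (y 0 i - x 0 i) (df i).
rewrite normrM mulrC !mxE ltn_ord; exact: ler_wpM2r.
Qed.

Lemma l1norm_le_norm x : l1norm x <= n%:R * `|x|.
Proof.
rewrite -[n in n%:R]card_ord -sum1_card natr_sum mulr_suml.
apply: ler_sum => i _; rewrite mul1r /Num.norm/= mx_normrE.
exact: (le_bigmax _ (fun ij : 'I_1 * 'I_n => `|x ij.1 ij.2|) (0, i)).
Qed.

Lemma bounded_partials_continuous (f : 'rV[R]_n -> R) (M : R) :
  (forall i x, derivable f x 'e_i) -> (forall i x, `|'D_'e_i f x| <= M) ->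
  continuous f.
Proof.
move=> df fM; apply: (@lipschitz_continuous _ _ _ (`|M| * n%:R)) => x y.
apply: le_trans (bounded_partials_lipschitz df fM y x) _.
rewrite -mulrA; apply: (@le_trans _ _ (`|M| * l1norm (x - y))).
  by apply: ler_wpM2r; [exact: l1norm_ge0|exact: ler_norm].
by apply: ler_wpM2l => //; exact: l1norm_le_norm.
Qed.

End Rows.

Section ComplexPartial.
Variables (R : realType) (n : nat).
Implicit Types (f g : 'rV[R]_n -> R[i]) (x : 'rV[R]_n) (i : 'I_n) (D E : R[i]).

Definition is_cpartial i f x D :=
  is_derive x 'e_i (fun y => complex.Re (f y)) (complex.Re D) /\
  is_derive x 'e_i (fun y => complex.Im (f y)) (complex.Im D).

Lemma is_cpartialP i f x : cderivable i f x -> is_cpartial i f x (cpartial i f x).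
Proof. by move=> [fr fi]; split; exact: derivableP. Qed.

Lemma is_cpartial_cderivable i f x D : is_cpartial i f x D -> cderivable i f x.
Proof. by move=> [fr fi]; split; exact: ex_derive. Qed.

Lemma is_cpartialE i f x D : is_cpartial i f x D -> cpartial i f x = D.
Proof.
by move=> [fr fi]; apply: complex_ext; rewrite /cpartial/= derive_val.
Qed.

Lemma is_cpartial_cst i (c : R[i]) x : is_cpartial i (fun=> c) x 0.
Proof. by split; exact: is_derive_cst. Qed.

Lemma is_cpartialM i f g x D E : is_cpartial i f x D -> is_cpartial i g x E ->
  is_cpartial i (fun y => f y * g y) x (D * g x + f x * E).
Proof.
move=> [fr fi] [gr gi]; split.
  under eq_fun do rewrite ReM.
  have frgr := is_deriveB (is_deriveM fr gr) (is_deriveM fi gi).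
  apply: (is_derive_eq frgr).
  by rewrite ReD !ReM /GRing.scale/=; ring.
under eq_fun do rewrite ImM.
have frgi := is_deriveD (is_deriveM fr gi) (is_deriveM fi gr).
apply: (is_derive_eq frgi).
by rewrite ImD !ImM /GRing.scale/=; ring.
Qed.

Lemma is_cpartialZ i (c : R[i]) f x D : is_cpartial i f x D ->
  is_cpartial i (fun y => c * f y) x (c * D).
Proof.
move=> fD; have := is_cpartialM (is_cpartial_cst i c x) fD.
by rewrite mul0r add0r.
Qed.

Lemma is_cpartial_conj i f x D : is_cpartial i f x D ->
  is_cpartial i (fun y => conjc (f y)) x (conjc D).
Proof.
move=> [fr fi]; split; first by under eq_fun do rewrite ReJ; rewrite ReJ.
by under eq_fun do rewrite ImJ; rewrite ImJ; exact: is_deriveN.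
Qed.

(** Reduction to one variable, where the chain rule for the exponential and the
    theorem on differentiation under the integral sign are available. *)
Lemma is_cpartial_line i f x D : is_cpartial i f x D <->
  is_derive (0 : R) 1 (fun h : R => complex.Re (f (x + h *: 'e_i))) (complex.Re D) /\
  is_derive (0 : R) 1 (fun h : R => complex.Im (f (x + h *: 'e_i))) (complex.Im D).
Proof.
have P (g : 'rV[R]_n -> R) d := is_derive_line0 g x 'e_i d.
split => -[fr fi]; split.
- exact/(P (fun y => complex.Re (f y))).
- exact/(P (fun y => complex.Im (f y))).
- exact/P.
- exact/P.
Qed.

Lemma is_cpartial_translate i f x (a : 'rV[R]_n) D :
  is_cpartial i f (x + a) D -> is_cpartial i (fun y => f (y + a)) x D.
Proof.
move=> /is_cpartial_line [fr fi]; apply/is_cpartial_line.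
by split; under eq_fun do rewrite addrAC.
Qed.

Lemma is_derive_cexp_line (a b : R[i]) (s : R) :
  is_derive s 1 (fun h : R => complex.Re (cexp (a + (h%:C)%C * b)))
    (complex.Re (b * cexp (a + (s%:C)%C * b))) /\
  is_derive s 1 (fun h : R => complex.Im (cexp (a + (h%:C)%C * b)))
    (complex.Im (b * cexp (a + (s%:C)%C * b))).
Proof.
case: a b => a a' [b b'].
have line (p q : R) : is_derive s 1 (fun h : R => p + h * q) q.
  have := is_deriveD (is_derive_cst p s 1)
    (is_deriveM (is_derive_id s 1) (is_derive_cst q s 1)).
  by move/is_derive_eq; apply; rewrite /GRing.scale/=; ring.
have eline p q : is_derive s 1 (fun h : R => expR (p + h * q)) (expR (p + s * q) * q).
  exact: (is_derive1_comp (is_derive_expR _) (line p q)).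
have cline p q : is_derive s 1 (fun h : R => cos (p + h * q)) (- sin (p + s * q) * q).
  exact: (is_derive1_comp (is_derive_cos _) (line p q)).
have sline p q : is_derive s 1 (fun h : R => sin (p + h * q)) (cos (p + s * q) * q).
  exact: (is_derive1_comp (is_derive_sin _) (line p q)).
have ReE h : complex.Re (cexp ((a +i* a')%C + (h%:C)%C * (b +i* b')%C)) =
  expR (a + h * b) * cos (a' + h * b') by rewrite /cexp /= !mul0r !subr0 !addr0.
have ImE h : complex.Im (cexp ((a +i* a')%C + (h%:C)%C * (b +i* b')%C)) =
  expR (a + h * b) * sin (a' + h * b') by rewrite /cexp /= !mul0r !subr0 !addr0.
split.
  under eq_fun do rewrite ReE.
  have ec := is_deriveM (eline a b) (cline a' b').
  by apply: (is_derive_eq ec); rewrite ReM ReE ImE /GRing.scale/=; ring.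
under eq_fun do rewrite ImE.
have es := is_deriveM (eline a b) (sline a' b').
by apply: (is_derive_eq es); rewrite ImM ReE ImE /GRing.scale/=; ring.
Qed.

Lemma cdotD (z : 'rV[R[i]]_n) (t u : 'rV[R]_n) :
  cdot z (t + u) = cdot z t + cdot z u.
Proof.
rewrite /cdot -big_split/=; apply: eq_bigr => j _.
by rewrite !mxE rmorphD/= mulrDr.
Qed.

Lemma cdotZ (z : 'rV[R[i]]_n) (h : R) (t : 'rV[R]_n) :
  cdot z (h *: t) = (h%:C)%C * cdot z t.
Proof.
rewrite /cdot mulr_sumr; apply: eq_bigr => j _.
by rewrite !mxE rmorphM/= mulrCA.
Qed.

Lemma cdot_delta (z : 'rV[R[i]]_n) i : cdot z 'e_i = z 0 i.
Proof.
rewrite /cdot (bigD1 i)//= big1 ?addr0 => [|j ji].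
  by rewrite !mxE !eqxx/= mulr1.
by rewrite !mxE (negbTE ji) andbF/= mulr0.
Qed.

Lemma is_cpartial_cexp i (c : R[i]) (z : 'rV[R[i]]_n) x :
  is_cpartial i (fun y => cexp (c * cdot z y)) x
    (c * z 0 i * cexp (c * cdot z x)).
Proof.
apply/is_cpartial_line; have := is_derive_cexp_line (c * cdot z x) (c * z 0 i) 0.
rewrite mul0r addr0.
have E h : c * cdot z (x + h *: 'e_i) = c * cdot z x + (h%:C)%C * (c * z 0 i).
  by rewrite cdotD cdotZ cdot_delta mulrDr mulrCA.
by split; under eq_fun do rewrite E; case: H.
Qed.

End ComplexPartial.

Section DerivationUnderIntegral.
Context d (T : measurableType d) (R : realType) (n : nat).
Variable mu : {measure set T -> \bar R}.

(** The majorant is only required near 0, because a translate of an exponentially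
    decaying function is dominated uniformly for bounded translations only. *)
Lemma is_derive_Rintegral (g g' : R -> T -> R) (M : T -> R) :
  (forall h, mu.-integrable setT (EFin \o g h)) ->
  (forall (h : R) y, is_derive h 1 (g ^~ y) (g' h y)) ->
  mu.-integrable setT (EFin \o M) -> (forall y, 0 <= M y) ->
  (forall h y, `|h| < 1 -> `|g' h y| <= M y) ->
  is_derive (0 : R) 1 (fun h => \int[mu]_y g h y) (\int[mu]_y g' 0 y).
Proof.
move=> ig dg iM M0 g'M.
have I0 : `](-1), 1[%classic (0 : R) by rewrite /= in_itv/= ltrN10 ltr01.
have ig' h : `](-1), 1[%classic h -> mu.-integrable setT (EFin \o g h) by move=> _.
have dg' h y : `](-1), 1[%classic h -> setT y -> derivable (g ^~ y) h 1.
  by move=> _ _; exact: ex_derive.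
have g1E h y : partial1of2 g h y = g' h y by rewrite partial1of2E derive_val.
have gM h y : `](-1), 1[%classic h -> setT y -> `|partial1of2 g h y| <= M y.
  by rewrite /= in_itv/= -ltr_norml g1E => h1 _; exact: g'M.
apply: DeriveDef.
  exact: (derivable_under_integral measurableT I0 ig' dg' M0 iM gM).
rewrite -derive1E.
rewrite (differentiation_under_integral measurableT I0 ig' dg' M0 iM gM).
by apply: eq_Rintegral => y _; exact: g1E.
Qed.

Lemma is_cpartial_cintegral (f f' : 'rV[R]_n -> T -> R[i]) (M : T -> R) i x :
  (forall y, cintegrable mu (f y)) ->
  (forall y t, is_cpartial i (f ^~ t) y (f' y t)) ->
  mu.-integrable setT (EFin \o M) ->
  (forall h t, `|h| < 1 -> normc (f' (x + h *: 'e_i) t) <= M t) ->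
  is_cpartial i (fun y => cintegral mu (f y)) x (cintegral mu (f' x)).
Proof.
move=> intf df iM f'M.
have M0 t : 0 <= M t.
  by apply: le_trans (normc_ge0 _) (f'M 0 t _); rewrite normr0.
apply/is_cpartial_line; rewrite -[in f' x](addr0 x) -(scale0r 'e_i).
split.
  apply: (@is_derive_Rintegral (fun h t => complex.Re (f (x + h *: 'e_i) t))
    (fun h t => complex.Re (f' (x + h *: 'e_i) t)) M) => //.
  - by move=> h; case: (intf (x + h *: 'e_i)).
  - move=> h t; have [dr _] := df (x + h *: 'e_i) t.
    exact: (iffRL (is_derive_line (fun y => complex.Re (f y t)) x 'e_i h _) dr).
  - by move=> h t h1; apply: le_trans (Re_le_normc _) (f'M _ _ h1).
apply: (@is_derive_Rintegral (fun h t => complex.Im (f (x + h *: 'e_i) t))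
  (fun h t => complex.Im (f' (x + h *: 'e_i) t)) M) => //.
- by move=> h; case: (intf (x + h *: 'e_i)).
- move=> h t; have [_ dr] := df (x + h *: 'e_i) t.
  exact: (iffRL (is_derive_line (fun y => complex.Im (f y t)) x 'e_i h _) dr).
- by move=> h t h1; apply: le_trans (Im_le_normc _) (f'M _ _ h1).
Qed.

End DerivationUnderIntegral.

(** * Iterated partial derivatives and exponential decay *)

Section IteratedPartials.
Variables (R : realType) (n : nat).
Implicit Types (f g : 'rV[R]_n -> R[i]) (i j : 'I_n) (w : seq 'I_n).

Lemma smooth_continuous f : smooth f -> continuous f.
Proof. by move=> sf; exact: (sf 0%N). Qed.

(** This is how continuity of the transforms is obtained: their partial
    derivatives are again bounded integrals. *)
Lemma bounded_cpartials_continuous f (D : 'I_n -> 'rV[R]_n -> R[i]) :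
  (forall i x, is_cpartial i f x (D i x)) ->
  (forall i, exists M, forall x, normc (D i x) <= M) -> continuous f.
Proof.
move=> fD /choice[M DM].
have {}DM i x : normc (D i x) <= \sum_j `|M j|.
  apply: le_trans (DM i x) _; rewrite (bigD1 i)//=.
  by apply: le_trans (ler_norm _) _; rewrite lerDl sumr_ge0.
apply: continuous_ReIm.
  apply: (@bounded_partials_continuous _ _ _ (\sum_j `|M j|)) => i x.
    by case: (fD i x) => dr _; exact: ex_derive.
  case: (fD i x) => dr _; rewrite derive_val.
  exact: le_trans (Re_le_normc _) (DM i x).
apply: (@bounded_partials_continuous _ _ _ (\sum_j `|M j|)) => i x.
  by case: (fD i x) => _ di; exact: ex_derive.
case: (fD i x) => _ di; rewrite derive_val.
exact: le_trans (Im_le_normc _) (DM i x).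
Qed.

Lemma cpartial_comm i j f : smooth f ->
  cpartial i (cpartial j f) = cpartial j (cpartial i f).
Proof.
move=> sf; apply/funext => x.
have dr k y := (smooth_cderivable k y sf).1.
have di k y := (smooth_cderivable k y sf).2.
have ddr k l y := (smooth_cderivable k y (smooth_cpartial l sf)).1.
have ddi k l y := (smooth_cderivable k y (smooth_cpartial l sf)).2.
have cdd k l := smooth_continuous (smooth_cpartial k (smooth_cpartial l sf)).
apply: complex_ext => /=.
  apply: (schwarz (dr j) (dr i) (ddr i j) (ddr j i)).
    exact: (cvg_Re (cdd i j x)).
  exact: (cvg_Re (cdd j i x)).
apply: (schwarz (di j) (di i) (ddi i j) (ddi j i)).
  exact: (cvg_Im (cdd i j x)).
exact: (cvg_Im (cdd j i x)).
Qed.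

(** Words of directions are used instead of multi-indices because they can be
    extended by one derivative at either end. *)
Definition dword w f : 'rV[R]_n -> R[i] := foldr (@cpartial R n) f w.

Lemma smooth_dword w f : smooth f -> smooth (dword w f).
Proof. by move=> sf; elim: w => // i w; exact: smooth_cpartial. Qed.

Lemma dword_cat w1 w2 f : dword (w1 ++ w2) f = dword w1 (dword w2 f).
Proof. by rewrite /dword foldr_cat. Qed.

Lemma dword_rcons w i f : dword (rcons w i) f = dword w (cpartial i f).
Proof. by rewrite -cats1 dword_cat. Qed.

Lemma dword_lin w (a : R[i]) f g : smooth f -> smooth g ->
  dword w (a *: f + g) = a *: dword w f + dword w g.
Proof.
move=> sf sg; elim: w => //= i w ->; rewrite cpartial_lin//.
  by move=> t; exact/smooth_cderivable/smooth_dword.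
by move=> t; exact/smooth_cderivable/smooth_dword.
Qed.

Lemma cpartial_dword i w f : smooth f ->
  cpartial i (dword w f) = dword w (cpartial i f).
Proof.
move=> sf; elim: w => //= j w <-.
by rewrite cpartial_comm//; exact: smooth_dword.
Qed.

Lemma perm_dword w1 w2 f : smooth f -> perm_eq w1 w2 -> dword w1 f = dword w2 f.
Proof.
move=> sf; elim: w1 w2 => [|i w1 IHw] w2; first by rewrite perm_sym => /perm_nilP ->.
move=> w12; have iw2 : i \in w2 by rewrite -(perm_mem w12) mem_head.
case/splitPr: iw2 w12 => p q w12.
rewrite dword_cat /= -cpartial_dword; last exact: smooth_dword.
rewrite -dword_cat; congr (cpartial i _); apply: IHw.
by move: w12; rewrite perm_sym -[i :: q]cat1s perm_catCA /= perm_cons perm_sym.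
Qed.

Definition word_of (alpha : {ffun 'I_n -> nat}) : seq 'I_n :=
  flatten [seq nseq (alpha i) i | i <- enum 'I_n].

Lemma mpartial_dword alpha f : mpartial alpha f = dword (word_of alpha) f.
Proof.
rewrite /mpartial /word_of; elim: (enum 'I_n) => //= i s ->.
rewrite dword_cat; move: (dword _ f) => g.
by elim: (alpha i) => //= m ->.
Qed.

Lemma size_word_of alpha : size (word_of alpha) = mdeg alpha.
Proof.
rewrite /word_of size_flatten /shape -map_comp /mdeg sumnE big_map.
rewrite big_enum /=; apply: eq_bigr => i _; exact: size_nseq.
Qed.

Lemma perm_word_of w : perm_eq w (word_of [ffun i => count_mem i w]).
Proof.
apply/allP => i _ /=; apply/eqP.
rewrite /word_of count_flatten -map_comp sumnE big_map big_enum /=.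
rewrite (bigD1 i)//= count_nseq/= eqxx mul1n ffunE big1 ?addn0// => j ji.
by rewrite count_nseq/= (negbTE ji).
Qed.

Lemma enorm_ge0 (t : 'rV[R]_n) : 0 <= enorm t.
Proof. exact: sqrtr_ge0. Qed.

Lemma entry_le_enorm (t : 'rV[R]_n) i : `|t 0 i| <= enorm t.
Proof.
rewrite -sqrtr_sqr ler_sqrt; last by apply: sumr_ge0 => j _; exact: sqr_ge0.
by rewrite (bigD1 i)//= lerDl; apply: sumr_ge0 => j _; exact: sqr_ge0.
Qed.

Lemma l1norm_le_enorm (t : 'rV[R]_n) : l1norm t <= n%:R * enorm t.
Proof.
rewrite -[n in n%:R]card_ord -sum1_card natr_sum mulr_suml.
by apply: ler_sum => i _; rewrite mul1r; exact: entry_le_enorm.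
Qed.

Lemma enorm_le_l1norm (t : 'rV[R]_n) : enorm t <= l1norm t.
Proof.
rewrite -[leRHS]ger0_norm ?l1norm_ge0// -sqrtr_sqr ler_sqrt ?sqr_ge0//.
rewrite expr2 {1}/l1norm mulr_suml; apply: ler_sum => i _.
rewrite -real_normK ?num_real// expr2 ler_wpM2l//; exact: entry_le_l1norm.
Qed.

(** The l1 norm is used instead of the equivalent Euclidean norm: its exponential
    is a product over the coordinates. *)
Definition decays (k m : nat) (C : R) f : Prop := forall w t, (size w <= m)%N ->
  expR (k%:R * l1norm t) * normc (dword w f t) <= C.

Lemma decays_le k m C f w t : decays k m C f -> (size w <= m)%N ->
  normc (dword w f t) <= C * expR (- (k%:R * l1norm t)).
Proof.
by move=> fC wm; rewrite expRN ler_pdivlMr ?expR_gt0// mulrC; exact: fC.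
Qed.

Lemma decays_cpartial k m C f i : decays k m.+1 C f -> decays k m C (cpartial i f).
Proof.
by move=> fC w t wm; rewrite -dword_rcons; apply: fC; rewrite size_rcons.
Qed.

Lemma decays_dword k m m' C f w : decays k m C f -> (size w + m' <= m)%N ->
  decays k m' C (dword w f).
Proof.
move=> fC wm v t vm; rewrite -dword_cat; apply: fC.
by rewrite size_cat addnC (leq_trans _ wm)// leq_add2l.
Qed.

Lemma decays_sub k k' m m' C f : (k' <= k)%N -> (m' <= m)%N ->
  decays k m C f -> decays k' m' C f.
Proof.
move=> kk mm fC w t wm; apply: le_trans (fC w t (leq_trans wm mm)).
by rewrite ler_wpM2r ?normc_ge0// ler_expR ler_wpM2r ?l1norm_ge0// ler_nat.
Qed.

Lemma decays_ge0 k m C f : decays k m C f -> 0 <= C.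
Proof.
move=> /(_ [::] 0 isT); apply: le_trans.
by rewrite mulr_ge0 ?expR_ge0 ?normc_ge0.
Qed.

Lemma K1_norm_ge0 k f : (0 <= K1_norm k f)%E.
Proof.
have : ((expR (k%:R * enorm (0 : 'rV[R]_n)) *
    normc (mpartial [ffun=> 0%N] f 0))%:E <= K1_norm k f)%E.
  apply: ereal_sup_ubound; exists (0, [ffun=> 0%N]) => //=.
  by rewrite /mdeg big1// => i _; rewrite ffunE.
by apply: le_trans; rewrite lee_fin mulr_ge0 ?expR_ge0 ?normc_ge0.
Qed.

(** The norms of the space only involve derivatives in a fixed order of the
    variables; by symmetry of mixed derivatives they control all words. *)
Lemma K1_norm_decays K k m f : smooth f -> (K1_norm K f < +oo)%E ->
  (n * k <= K)%N -> (m <= K)%N -> decays k m (fine (K1_norm K f)) f.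
Proof.
move=> sf fK nkK mK w t wm; rewrite -lee_fin fineK; last first.
  by rewrite ge0_fin_numE// K1_norm_ge0.
apply: (@le_trans _ _ (expR (K%:R * enorm t) * normc (dword w f t))%:E).
  rewrite lee_fin ler_wpM2r ?normc_ge0// ler_expR.
  apply: (@le_trans _ _ (k%:R * (n%:R * enorm t))).
    by rewrite ler_wpM2l// l1norm_le_enorm.
  by rewrite mulrA ler_wpM2r ?enorm_ge0// -natrM ler_nat mulnC.
rewrite (perm_dword sf (perm_word_of w)) -mpartial_dword.
apply: ereal_sup_ubound; exists (t, [ffun i => count_mem i w]) => //=.
by rewrite -size_word_of -(perm_size (perm_word_of w)) (leq_trans wm).
Qed.

Lemma decays_K1_norm k C f : decays k k C f -> (K1_norm k f <= C%:E)%E.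
Proof.
move=> fC; apply: ge_ereal_sup => _ [[t a] /= ak <-].
have /(fC _ t) : (size (word_of a) <= k)%N by rewrite size_word_of.
rewrite lee_fin mpartial_dword; apply: le_trans.
by rewrite ler_wpM2r ?normc_ge0// ler_expR ler_wpM2l// enorm_le_l1norm.
Qed.

Lemma K1_norm_homo k k' f : (k <= k')%N -> (K1_norm k f <= K1_norm k' f)%E.
Proof.
move=> kk; apply: ge_ereal_sup => _ [[t a] /= ak <-].
apply: (@le_trans _ _ (expR (k'%:R * enorm t) * normc (mpartial a f t))%:E).
  rewrite lee_fin ler_wpM2r ?normc_ge0// ler_expR ler_wpM2r ?enorm_ge0//.
  by rewrite ler_nat.
by apply: ereal_sup_ubound; exists (t, a) => //=; exact: leq_trans kk.
Qed.

End IteratedPartials.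

(** * Integrals of exponentially decaying functions *)

Lemma continuous_translate (R : realType) (V : normedModType R)
    (T : topologicalType) (u : V -> T) (y : V) :
  continuous u -> continuous (fun t => u (t + y)).
Proof.
move=> cu t; apply: (continuous_comp (f := fun t => t + y) (g := u)); last exact: cu.
by apply: cvgD; [exact: cvg_id|exact: cvg_cst].
Qed.

Lemma continuous_reflect (R : realType) (V : normedModType R)
    (T : topologicalType) (u : V -> T) (y : V) :
  continuous u -> continuous (fun t => u (y - t)).
Proof.
move=> cu t; apply: (continuous_comp (f := fun t => y - t) (g := u)); last exact: cu.
by apply: cvgB; [exact: cvg_cst|exact: cvg_id].
Qed.

Section WeightedIntegrals.
Variables (R : realType) (n : nat).
Local Notation mu := (lebesgue_tuple R n).

(** In each coordinate, [1 + t^2 <= (1 + |t|)^2 <= exp (2 |t|)]. *)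
Lemma exp_le_rational_weight (t : 'rV[R]_n) :
  expR (- (2 * l1norm t)) <= rational_weight t.
Proof.
rewrite /l1norm mulr_sumr -sumrN expR_sum; apply: ler_prod => i _.
rewrite expR_ge0/= expRN lef_pV2 ?posrE ?expR_gt0 ?(lt_le_trans ltr01)//.
rewrite mulr_natl mulr2n expRD.
have e1 : 1 + `|t 0 i| <= expR `|t 0 i| by exact: expR_ge1Dx.
apply: (@le_trans _ _ ((1 + `|t 0 i|) ^+ 2)); last first.
  by rewrite expr2 ler_pM// addr_ge0.
rewrite /oneDsqr -[t 0 i ^+ 2]real_normK ?num_real//.
by have := normr_ge0 (t 0 i); lra.
Qed.

Lemma continuous_cmeasurable_row (f : 'rV[R]_n -> R[i]) :
  continuous f -> cmeasurable (fun s : Rtuple R n => f (row_of_tuple s)).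
Proof.
move=> cf; split.
  apply: (continuous_measurable_row (f := fun t => complex.Re (f t))) => t.
  exact: (cvg_Re (cf t)).
apply: (continuous_measurable_row (f := fun t => complex.Im (f t))) => t.
exact: (cvg_Im (cf t)).
Qed.

Lemma integrable_weightM (c : R) :
  mu.-integrable setT (EFin \o (fun s => c * rational_weight (row_of_tuple s))).
Proof.
rewrite /comp; under eq_fun do rewrite EFinM.
by apply: integrableZl => //; exact: integrable_rational_weight.
Qed.

Lemma Rintegral_weightM (c : R) :
  \int[mu]_s (c * rational_weight (row_of_tuple s)) = c * pi ^+ n.
Proof.
rewrite RintegralZl//; last exact: integrable_rational_weight.
by rewrite /Rintegral rational_weight_integral.
Qed.

Lemma exp_decay_cintegrable (f : Rtuple R n -> R[i]) (c : R) :
  cmeasurable f ->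
  (forall s, normc (f s) <= c * expR (- (2 * l1norm (row_of_tuple s)))) ->
  cintegrable mu f /\ normc (cintegral mu f) <= 2 * pi ^+ n * c.
Proof.
move=> mf fc.
have c0 : 0 <= c.
  have := le_trans (normc_ge0 _) (fc point).
  by rewrite pmulr_lge0// expR_gt0.
have fw s : normc (f s) <= c * rational_weight (row_of_tuple s).
  by apply: le_trans (fc s) _; rewrite ler_wpM2l// exp_le_rational_weight.
split; first exact: (le_cintegrable mf (integrable_weightM c) fw).
apply: le_trans (le_normc_cintegral mf (integrable_weightM c) fw) _.
by rewrite Rintegral_weightM mulrCA mulrC.
Qed.

End WeightedIntegrals.

Section ReflectedPartial.
Variables (R : realType) (n : nat).

Lemma is_cpartial_reflect (f : 'rV[R]_n -> R[i]) i (a x : 'rV[R]_n) D :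
  is_cpartial i f (a - x) D -> is_cpartial i (fun y => f (a - y)) x (- D).
Proof.
move=> /is_cpartial_line [fr fi]; apply/is_cpartial_line.
have E (h : R) : a - (x + h *: 'e_i) = (a - x) + (- h) *: 'e_i.
  by rewrite opprD addrA scaleNr.
have dN : is_derive (0 : R) 1 (fun h : R => - h) (-1).
  exact: (is_deriveN (is_derive_id (0 : R) 1)).
rewrite -[X in is_derive X](@oppr0 R) in fr fi.
split; under eq_fun do rewrite E.
  by rewrite ReN -mulrN1; exact: (is_derive1_comp fr dN).
by rewrite ImN -mulrN1; exact: (is_derive1_comp fi dN).
Qed.

End ReflectedPartial.

Section IntegralOfPartial.
Variables (R : realType) (n : nat).

(** Translation invariance makes [y |-> \int u (t + y) dt] constant, so that
    its derivative [\int D] vanishes. *)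
Lemma cintegral_partial_eq0 (u D : 'rV[R]_n -> R[i]) (c : R) i :
  continuous u -> (forall t, is_cpartial i u t (D t)) ->
  (forall t, normc (u t) <= c * expR (- (2 * l1norm t))) ->
  (forall t, normc (D t) <= c * expR (- (2 * l1norm t))) ->
  cintegral (lebesgue_tuple R n) (fun s => D (row_of_tuple s)) = 0.
Proof.
move=> cu uD uc Dc.
have c0 : 0 <= c.
  by have := le_trans (normc_ge0 _) (uc 0); rewrite pmulr_lge0// expR_gt0.
have shift_exp (t y : 'rV[R]_n) : expR (- (2 * l1norm (t + y))) <=
    expR (2 * l1norm y) * expR (- (2 * l1norm t)).
  rewrite -expRD ler_expR.
  have := l1normD (t + y) (- y); rewrite addrK l1normN; lra.
have cuy (y : 'rV[R]_n) : continuous (fun t : 'rV[R]_n => u (t + y)).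
  exact: continuous_translate.
pose I (y : 'rV[R]_n) := cintegral (lebesgue_tuple R n) (fun s => u (row_of_tuple s + y)).
have intu y : cintegrable (lebesgue_tuple R n) (fun s => u (row_of_tuple s + y)).
  apply: (exp_decay_cintegrable (c := c * expR (2 * l1norm y)) _ _).1.
    exact: (continuous_cmeasurable_row (cuy y)).
  move=> s; apply: le_trans (uc _) _.
  by rewrite -mulrA ler_wpM2l.
have Icst y : I y = I 0.
  rewrite /I cintegral_translate; last exact: continuous_cmeasurable_row.
  by congr cintegral; apply/funext => s; rewrite addr0.
have dI : is_cpartial i I 0 (cintegral (lebesgue_tuple R n)
    (fun s => D (row_of_tuple s + 0))).
  apply: (@is_cpartial_cintegral _ _ _ _ _ (fun y s => u (row_of_tuple s + y))
    (fun y s => D (row_of_tuple s + y))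
    (fun s => c * expR 2 * rational_weight (row_of_tuple s))).
  - exact: intu.
  - move=> y s; under eq_fun do rewrite addrC.
    by apply: is_cpartial_translate; rewrite addrC.
  - exact: integrable_weightM.
  move=> h s h1; apply: le_trans (Dc _) _; rewrite -mulrA ler_wpM2l//.
  rewrite add0r; apply: le_trans (shift_exp _ _) _.
  apply: ler_pM; rewrite ?expR_ge0//; last exact: exp_le_rational_weight.
  by rewrite ler_expR l1norm_delta; move: h1; lra.
have := is_cpartialE dI.
have -> : I = fun=> I 0 by apply/funext => y; exact: Icst.
rewrite (is_cpartialE (is_cpartial_cst _ _ _)) => ->.
by congr cintegral; apply/funext => s; rewrite addr0.
Qed.

End IntegralOfPartial.

(** * The short-time Fourier transform *)

Section RapidDecay.
Variables (R : realType) (n : nat).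
Implicit Types (f g : 'rV[R]_n -> R[i]).

(** The elements of the space of test functions, with the order of derivation and
    the rate of decay decoupled. *)
Definition rapid f := smooth f /\ forall k m, exists C, decays k m C f.

Lemma rapid_cpartial i f : rapid f -> rapid (cpartial i f).
Proof.
move=> [sf df]; split; first exact: smooth_cpartial.
by move=> k m; have [C fC] := df k m.+1; exists C; exact: decays_cpartial.
Qed.

Lemma rapid_dword w f : rapid f -> rapid (dword w f).
Proof. by move=> rf; elim: w => // i w; exact: rapid_cpartial. Qed.

Lemma rapid_continuous f : rapid f -> continuous f.
Proof. by move=> [sf _]; exact: smooth_continuous. Qed.

Lemma rapid_is_cpartial f i x : rapid f -> is_cpartial i f x (cpartial i f x).
Proof. by move=> [sf _]; exact/is_cpartialP/smooth_cderivable. Qed.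

Lemma K1_rapid f : f \in @K1_pred R n -> rapid f.
Proof.
rewrite inE => -[sf fk]; split => // k m.
exists (fine (K1_norm (n * k + m) f)).
by apply: K1_norm_decays => //; [exact: leq_addr|exact: leq_addl].
Qed.

End RapidDecay.

Section Stft.
Variables (R : realType) (n : nat).
Implicit Types (phi psi : 'rV[R]_n -> R[i]) (x t : 'rV[R]_n) (z : 'rV[R[i]]_n).
Local Notation mu := (lebesgue_tuple R n).
Local Notation tau := ((2 * pi)%:C%C * 'i%C).

Lemma two_pi_le8 : 2 * pi <= 8 :> R.
Proof. by have := @pihalf_lt2 R; lra. Qed.

Lemma normc_tau : normc (tau : R[i]) = 2 * pi.
Proof.
rewrite normcM normc_real normc_i mulr1 ger0_norm//.
by rewrite mulr_ge0// pi_ge0.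
Qed.

Lemma Im_cdot z t : complex.Im (cdot z t) = \sum_i complex.Im (z 0 i) * t 0 i.
Proof.
by rewrite /cdot Im_sum; apply: eq_bigr => i _; rewrite ImM/= mulr0 add0r.
Qed.

(** The constant 8 is an integer above [2 pi], so that rates of decay remain
    natural numbers. *)
Lemma normc_kernel (N : nat) z t : strip N z ->
  normc (cexp (- (tau * cdot z t))) <= expR (8 * N%:R * l1norm t).
Proof.
move=> zN; rewrite normc_cexp ler_expR ReN.
have -> : - complex.Re (tau * cdot z t) = 2 * pi * complex.Im (cdot z t).
  by rewrite !ReM !ImM/=; ring.
rewrite Im_cdot.
have cN : \sum_i complex.Im (z 0 i) * t 0 i <= N%:R * l1norm t.
  rewrite /l1norm mulr_sumr; apply: ler_sum => i _.
  by apply: le_trans (ler_norm _) _; rewrite normrM ler_wpM2r.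
have Nt0 : 0 <= N%:R * l1norm t by rewrite mulr_ge0// l1norm_ge0.
have p0 := @pi_gt0 R; have p8 := two_pi_le8.
apply: (@le_trans _ _ (2 * pi * (N%:R * l1norm t))).
  by rewrite ler_pM2l// mulr_gt0.
by rewrite -[leRHS]mulrA ler_wpM2r.
Qed.

Lemma in_strip z : exists N, strip N z.
Proof.
exists (Num.trunc (\sum_i `|complex.Im (z 0 i)|)).+1 => i.
apply: (@le_trans _ _ (\sum_i `|complex.Im (z 0 i)|)).
  by rewrite (bigD1 i)//= lerDl sumr_ge0.
by apply: ltW; rewrite truncnS_gt.
Qed.

Lemma cmeasurable_kernel z :
  cmeasurable (fun s : Rtuple R n => cexp (- (tau * cdot z (row_of_tuple s)))).
Proof.
apply: cmeasurable_cexp.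
under eq_fun do rewrite -mulNr.
apply: cmeasurableM; first exact: cmeasurable_cst.
apply: cmeasurable_sum => i; apply: cmeasurableM; first exact: cmeasurable_cst.
apply: cmeasurable_real; under eq_fun do rewrite mxE.
exact: measurable_tnth.
Qed.

Lemma cmeasurable_stft_integrand psi phi x z : continuous phi -> continuous psi ->
  cmeasurable (fun s : Rtuple R n => stft_integrand psi phi x z (row_of_tuple s)).
Proof.
move=> cphi cpsi; apply: cmeasurableM; last exact: cmeasurable_kernel.
apply: cmeasurableM; first exact: continuous_cmeasurable_row.
apply: cmeasurable_conj.
apply: (continuous_cmeasurable_row (f := fun t => psi (t - x))).
exact: continuous_translate.
Qed.

(** The factor [exp (k |x|)] is shared between psi and phi; what phi has to pay
    for is this share, the growth [exp (2 pi N |t|)] of the kernel on the strip,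
    and the [exp (- 2 |t|)] that makes the integral converge. *)
Lemma stft_integrand_decays q K k (N : nat) A B psi phi x z t :
  (k + 8 * N + q <= K)%N -> decays K 0 A phi -> decays k 0 B psi -> strip N z ->
  expR (k%:R * l1norm x) * normc (stft_integrand psi phi x z t) <=
  A * B * expR (- (q%:R * l1norm t)).
Proof.
move=> KN phiA psiB zN; rewrite /stft_integrand (normcM (phi t * _)) (normcM (phi t)) normcJ.
have p1 : normc (phi t) <= A * expR (- (K%:R * l1norm t)).
  exact: (decays_le t phiA (w := [::])).
have p2 : normc (psi (t - x)) <= B * expR (- (k%:R * l1norm (t - x))).
  exact: (decays_le (t - x) psiB (w := [::])).
have p3 := normc_kernel t zN.
have A0 := decays_ge0 phiA; have B0 := decays_ge0 psiB.
apply: (@le_trans _ _ (expR (k%:R * l1norm x) *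
   (A * expR (- (K%:R * l1norm t)) * (B * expR (- (k%:R * l1norm (t - x)))) *
    expR (8 * N%:R * l1norm t)))).
  apply: ler_wpM2l; first exact: expR_ge0.
  apply: ler_pM; [by rewrite mulr_ge0 ?normc_ge0|exact: normc_ge0| |exact: p3].
  by apply: ler_pM; rewrite ?normc_ge0.
rewrite [leLHS](_ : _ = A * B * expR (k%:R * l1norm x - K%:R * l1norm t -
    k%:R * l1norm (t - x) + 8 * N%:R * l1norm t)); last first.
  by rewrite !expRD; ring.
rewrite ler_wpM2l ?mulr_ge0// ler_expR.
have xt : l1norm x <= l1norm (t - x) + l1norm t.
  by rewrite -(l1normN (t - x)) -{1}(subrK t x) -(opprB t x) l1normD.
have kxt : k%:R * l1norm x <= k%:R * (l1norm (t - x) + l1norm t).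
  by rewrite ler_wpM2l.
have KNt : (k%:R + 8 * N%:R + q%:R) * l1norm t <= K%:R * l1norm t.
  by rewrite ler_wpM2r ?l1norm_ge0// -natrM -!natrD ler_nat.
lra.
Qed.

Lemma stft_bounded K k (N : nat) A B psi phi x z :
  continuous phi -> continuous psi ->
  (k + 8 * N + 2 <= K)%N -> decays K 0 A phi -> decays k 0 B psi -> strip N z ->
  cintegrable mu (fun s => stft_integrand psi phi x z (row_of_tuple s)) /\
  expR (k%:R * l1norm x) * normc (stft psi phi x z) <= 2 * pi ^+ n * (A * B).
Proof.
move=> cphi cpsi KN phiA psiB zN.
have D s : normc (stft_integrand psi phi x z (row_of_tuple s)) <=
    expR (- (k%:R * l1norm x)) * (A * B) * expR (- (2 * l1norm (row_of_tuple s))).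
  rewrite -mulrA expRN ler_pdivlMl ?expR_gt0//.
  exact: stft_integrand_decays KN phiA psiB zN.
have [int le] := exp_decay_cintegrable
  (cmeasurable_stft_integrand x z cphi cpsi) D.
split => //; rewrite -ler_pdivlMl ?expR_gt0// -expRN.
by apply: le_trans le _; rewrite mulrCA.
Qed.

Lemma stft_cintegrable psi phi x z : rapid phi -> rapid psi ->
  cintegrable mu (fun s => stft_integrand psi phi x z (row_of_tuple s)).
Proof.
move=> rphi rpsi; have [N zN] := in_strip z.
have [A phiA] := rphi.2 (0 + 8 * N + 2)%N 0%N; have [B psiB] := rpsi.2 0%N 0%N.
exact: (stft_bounded x (rapid_continuous rphi) (rapid_continuous rpsi)
  (leqnn _) phiA psiB zN).1.
Qed.

Lemma is_cpartial_stft psi phi z i x : rapid phi -> rapid psi ->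
  is_cpartial i (fun y => stft psi phi y z) x (- stft (cpartial i psi) phi x z).
Proof.
move=> rphi rpsi; have rdpsi := rapid_cpartial i rpsi.
have [N zN] := in_strip z.
have [A phiA] := rphi.2 (0 + 8 * N + 2)%N 0%N.
have [B psiB] := rdpsi.2 0%N 0%N.
rewrite /stft -cintegralN; last exact: stft_cintegrable.
apply: (is_cpartial_cintegral
  (f := fun y s => stft_integrand psi phi y z (row_of_tuple s))
  (f' := fun y s => - stft_integrand (cpartial i psi) phi y z (row_of_tuple s))
  (M := fun s => A * B * rational_weight (row_of_tuple s))).
- by move=> y; exact: stft_cintegrable.
- move=> y s; rewrite /stft_integrand; set E := cexp _; set t := row_of_tuple s.
  have dpsi := is_cpartialZ (phi t * E)
    (is_cpartial_conj (is_cpartial_reflect (rapid_is_cpartial i (t - y) rpsi))).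
  have -> : - (phi t * conjc (cpartial i psi (t - y)) * E) =
    phi t * E * conjc (- cpartial i psi (t - y)) by rewrite rmorphN/=; ring.
  by under eq_fun do rewrite mulrAC.
- exact: integrable_weightM.
move=> h s _; rewrite normcN.
have := stft_integrand_decays (x + h *: 'e_i) (row_of_tuple s) (leqnn _) phiA psiB zN.
rewrite mul0r expR0 mul1r => /le_trans; apply.
rewrite ler_wpM2l ?exp_le_rational_weight//.
by rewrite mulr_ge0// ?(decays_ge0 phiA) ?(decays_ge0 psiB).
Qed.

Lemma classC_opp r (f : 'rV[R]_n -> R[i]) : classC r f -> classC r (fun x => - f x).
Proof.
move=> cf; have := classC_lin (-1) cf (classC0 R n r).
rewrite (_ : -1 *: f + 0 = fun x => - f x)//; apply/funext => x.
by apply: etrans (addr0 _) _; exact: mulN1r.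
Qed.

Lemma smooth_stft psi phi z : rapid phi -> rapid psi ->
  smooth (fun x => stft psi phi x z).
Proof.
move=> rphi rpsi r; elim: r psi rpsi => [|r IHr] psi rpsi /=.
  apply: (bounded_cpartials_continuous (fun i x => is_cpartial_stft z i x rphi rpsi)).
  move=> i; have [N zN] := in_strip z.
  have [A phiA] := rphi.2 (0 + 8 * N + 2)%N 0%N.
  have rdpsi := rapid_cpartial i rpsi; have [B psiB] := rdpsi.2 0%N 0%N.
  exists (2 * pi ^+ n * (A * B)) => x; rewrite normcN.
  have [_] := stft_bounded x (rapid_continuous rphi) (rapid_continuous rdpsi)
    (leqnn _) phiA psiB zN.
  by rewrite mul0r expR0 mul1r.
split; first by have := IHr psi rpsi; case: (r) => [|q []].
move=> i; split.
  by move=> x; exact: is_cpartial_cderivable (is_cpartial_stft z i x rphi rpsi).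
have -> : cpartial i (fun x => stft psi phi x z) =
    fun x => - stft (cpartial i psi) phi x z.
  by apply/funext => x; exact: is_cpartialE (is_cpartial_stft z i x rphi rpsi).
by apply: classC_opp; apply: IHr; exact: rapid_cpartial.
Qed.

Lemma dword_stft w psi phi z : rapid phi -> rapid psi ->
  dword w (fun x => stft psi phi x z) =
  fun x => (-1) ^+ size w * stft (dword w psi) phi x z.
Proof.
move=> rphi rpsi; elim: w => [|i w /= ->].
  by apply/funext => x; rewrite mul1r.
apply/funext => x.
have := is_cpartialZ ((-1) ^+ size w)
  (is_cpartial_stft z i x rphi (rapid_dword w rpsi)).
by move=> /is_cpartialE ->; rewrite exprS mulrN mulN1r mulNr.
Qed.

Lemma stft_integrand_exp (q : nat) psi phi x z : rapid phi -> rapid psi ->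
  exists2 c, 0 <= c & forall t,
    normc (stft_integrand psi phi x z t) <= c * expR (- (q%:R * l1norm t)).
Proof.
move=> rphi rpsi; have [N zN] := in_strip z.
have [A phiA] := rphi.2 (0 + 8 * N + q)%N 0%N; have [B psiB] := rpsi.2 0%N 0%N.
exists (A * B) => [|t]; first by rewrite mulr_ge0 ?(decays_ge0 phiA) ?(decays_ge0 psiB).
have := stft_integrand_decays x t (leqnn _) phiA psiB zN.
by rewrite mul0r expR0 mul1r.
Qed.

(** Integration by parts: the transform turns derivatives of
    [phi * conj (psi (. - x))] into multiplication by [2 pi i z_j]. *)
Lemma stft_mulz psi phi x z j : rapid phi -> rapid psi ->
  tau * z 0 j * stft psi phi x z =
  stft psi (cpartial j phi) x z + stft (cpartial j psi) phi x z.
Proof.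
move=> rphi rpsi.
pose u := stft_integrand psi phi x z.
pose D i t := stft_integrand psi (cpartial i phi) x z t +
  stft_integrand (cpartial i psi) phi x z t + (- (tau * z 0 i)) * u t.
have uD i t : is_cpartial i u t (D i t).
  rewrite /D /u /stft_integrand.
  have dphi := rapid_is_cpartial i t rphi.
  have dpsi := is_cpartial_conj (is_cpartial_translate (rapid_is_cpartial i (t - x) rpsi)).
  have dE := is_cpartial_cexp i (- tau) z t.
  have := is_cpartialM (is_cpartialM dphi dpsi) dE.
  under eq_fun do rewrite mulNr.
  by congr is_cpartial; rewrite !mulNr; ring.
have [a a0 ua] := stft_integrand_exp 2 x z rphi rpsi.
have Dexp i : exists2 c, 0 <= c & forall t, normc (D i t) <= c * expR (- (2 * l1norm t)).
  have [b b0 ub] := stft_integrand_exp 2 x z (rapid_cpartial i rphi) rpsi.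
  have [c c0 uc] := stft_integrand_exp 2 x z rphi (rapid_cpartial i rpsi).
  exists (b + c + normc (- (tau * z 0 i)) * a).
    by rewrite !addr_ge0// mulr_ge0// normc_ge0.
  move=> t; set e := expR _; apply: le_trans (le_normcD _ _) _.
  rewrite (normcM (- _) (u t)) [leRHS](_ : _ =
    b * e + c * e + normc (- (tau * z 0 i)) * (a * e)); last by ring.
  apply: lerD; last by rewrite ler_wpM2l ?normc_ge0 ?ua.
  by apply: le_trans (le_normcD _ _) _; exact: lerD (ub t) (uc t).
have cu : continuous u.
  apply: (bounded_cpartials_continuous uD) => i; have [c c0 Dc] := Dexp i.
  exists c => t; apply: le_trans (Dc t) _; rewrite ler_piMr// -expR0 ler_expR.
  by rewrite lerNl oppr0 mulr_ge0// l1norm_ge0.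
have [c c0 Dc] := Dexp j.
have /(_ _ _)/= := cintegral_partial_eq0 (c := a + c) cu (uD j).
have ule t : normc (u t) <= (a + c) * expR (- (2 * l1norm t)).
  by apply: le_trans (ua t) _; rewrite ler_wpM2r ?expR_ge0// lerDl.
have Dle t : normc (D j t) <= (a + c) * expR (- (2 * l1norm t)).
  by apply: le_trans (Dc t) _; rewrite ler_wpM2r ?expR_ge0// lerDr.
move=> /(_ ule Dle).
have int1 := stft_cintegrable x z (rapid_cpartial j rphi) rpsi.
have int2 := stft_cintegrable x z rphi (rapid_cpartial j rpsi).
have int3 := stft_cintegrable x z rphi rpsi.
rewrite cintegralD; [|exact: cintegrableD|exact: cintegrableZ].
rewrite cintegralD// cintegralZ// mulNr => /eqP; rewrite subr_eq0 => /eqP.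
by rewrite /stft => ->.
Qed.

(** Each power of [z_j] costs one derivative, which falls either on phi or on
    psi. *)
Lemma stft_power_bounded m K k (N : nat) A B psi phi x z j :
  rapid phi -> rapid psi -> (k + 8 * N + 2 <= K)%N ->
  decays K m A phi -> decays k m B psi -> strip N z ->
  expR (k%:R * l1norm x) * (normc (z 0 j) ^+ m * normc (stft psi phi x z)) <=
  2 ^+ m * (2 * pi ^+ n * (A * B)).
Proof.
move=> + + KN + + zN.
elim: m phi psi => [|m IHm] phi psi rphi rpsi phiA psiB.
  rewrite !mul1r.
  exact: (stft_bounded x (rapid_continuous rphi) (rapid_continuous rpsi)
    KN phiA psiB zN).2.
have IH1 := IHm _ _ (rapid_cpartial j rphi) rpsi (decays_cpartial j phiA)
  (decays_sub (leqnn k) (leqnSn m) psiB).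
have IH2 := IHm _ _ rphi (rapid_cpartial j rpsi)
  (decays_sub (leqnn K) (leqnSn m) phiA) (decays_cpartial j psiB).
have zV : normc (z 0 j) * normc (stft psi phi x z) <=
    normc (stft psi (cpartial j phi) x z) + normc (stft (cpartial j psi) phi x z).
  apply: le_trans (le_normcD _ _); rewrite -stft_mulz// !(normcM _ (stft _ _ _ _)).
  rewrite ler_wpM2r ?normc_ge0// (normcM tau) normc_tau ler_peMl ?normc_ge0//.
  by have := @pi_ge2 R; lra.
rewrite [in leRHS]exprS -[leRHS]mulrA [leRHS]mulr_natl mulr2n.
apply: le_trans (lerD IH1 IH2); rewrite -!mulrDr exprSr -mulrA.
by rewrite ler_wpM2l ?expR_ge0// ler_wpM2l ?exprn_ge0 ?normc_ge0.
Qed.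



End Stft.

(** * Holomorphy of the short-time Fourier transform *)

Section ComplexExponential.
Variable R : realType.
Implicit Types w : R[i].

Lemma unit_segment_lipschitz (F F' : R -> R) (M s : R) :
  (forall u : R, is_derive u 1 F (F' u)) ->
  (forall u, 0 <= u <= 1 -> `|F' u| <= M) -> 0 <= s <= 1 -> `|F s - F 0| <= M.
Proof.
move=> dF F'M /andP[s0 s1].
have cF : continuous F.
  by move=> u; apply: differentiable_continuous; apply/derivable1_diffP; exact: ex_derive.
have [u] := MVT_segment s0 (fun u _ => dF u) (continuous_subspaceT cF).
rewrite in_itv/= => /andP[u0 us] ->; rewrite subr0 normrM (ger0_norm s0).
by rewrite (le_trans _ (F'M u _)) ?ler_piMr// u0 (le_trans us).
Qed.

Let segment_exp w (u : R) : 0 <= u <= 1 ->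
  normc (cexp ((u%:C)%C * w)) <= expR (normc w).
Proof.
move=> /andP[u0 u1]; rewrite normc_cexp ler_expR ReM/= mul0r subr0.
apply: le_trans (ler_norm _) _; rewrite normrM ger0_norm//.
by rewrite (le_trans _ (Re_le_normc w))// ler_piMl.
Qed.

Lemma normc_cexpB1 w (s : R) : 0 <= s <= 1 ->
  normc (cexp ((s%:C)%C * w) - 1) <= 2 * (normc w * expR (normc w)).
Proof.
move=> s01.
have dexp u := is_derive_cexp_line 0 w u.
have wM (u : R) : 0 <= u <= 1 ->
    normc (w * cexp (0 + (u%:C)%C * w)) <= normc w * expR (normc w).
  by move=> u01; rewrite normcM add0r ler_wpM2l ?normc_ge0// segment_exp.
have re := unit_segment_lipschitz (fun u => (dexp u).1)
  (fun u u01 => le_trans (Re_le_normc _) (wM u u01)) s01.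
have im := unit_segment_lipschitz (fun u => (dexp u).2)
  (fun u u01 => le_trans (Im_le_normc _) (wM u u01)) s01.
apply: le_trans (normc_le_ReIm _) _; rewrite ReD ReN ImD ImN.
by move: re im; rewrite !add0r mul0r cexp0 => re im; rewrite mulr_natl mulr2n lerD.
Qed.

(** The derivative of [s |-> cexp (s w) - s w] on the unit segment is
    [w (cexp (s w) - 1)]; the mean value theorem for the real and imaginary parts
    is used once for it and once for [cexp (s w) - 1]. *)
Lemma normc_cexp_taylor w :
  normc (cexp w - 1 - w) <= 4 * (normc w ^+ 2 * expR (normc w)).
Proof.
have dexp u := is_derive_cexp_line 0 w u.
have line (a s : R) : is_derive s 1 (fun u : R => u * a) a.
  have da := is_deriveM (is_derive_id s 1) (is_derive_cst a s 1).
  by apply: (is_derive_eq da); rewrite /GRing.scale/=; ring.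
have dre (u : R) : is_derive u 1
    (fun u => complex.Re (cexp (0 + (u%:C)%C * w)) - u * complex.Re w)
    (complex.Re (w * (cexp (0 + (u%:C)%C * w) - 1))).
  by rewrite mulrBr mulr1 ReD ReN; exact: (is_deriveB (dexp u).1 (line _ _)).
have dim (u : R) : is_derive u 1
    (fun u => complex.Im (cexp (0 + (u%:C)%C * w)) - u * complex.Im w)
    (complex.Im (w * (cexp (0 + (u%:C)%C * w) - 1))).
  by rewrite mulrBr mulr1 ImD ImN; exact: (is_deriveB (dexp u).2 (line _ _)).
have wM (u : R) : 0 <= u <= 1 ->
    normc (w * (cexp (0 + (u%:C)%C * w) - 1)) <=
    2 * (normc w ^+ 2 * expR (normc w)).
  move=> u01; rewrite normcM add0r.
  apply: le_trans (ler_wpM2l (normc_ge0 _) (normc_cexpB1 w u01)) _.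
  by rewrite mulrCA expr2 -mulrA.
have i01 : (0 : R) <= (1 : R) <= 1 by rewrite ler01 lexx.
have re := unit_segment_lipschitz (s := 1) dre
  (fun u u01 => le_trans (Re_le_normc _) (wM u u01)) i01.
have im := unit_segment_lipschitz (s := 1) dim
  (fun u u01 => le_trans (Im_le_normc _) (wM u u01)) i01.
apply: le_trans (normc_le_ReIm _) _; rewrite !ReD !ReN !ImD !ImN.
move: re im; rewrite !add0r !mul0r !mul1r !subr0 cexp0 => re im.
rewrite [leRHS](_ : _ = 2 * (normc w ^+ 2 * expR (normc w)) +
  2 * (normc w ^+ 2 * expR (normc w))); last by ring.
apply: lerD; first by rewrite addrAC.
by move: im; rewrite (_ : complex.Im 1 = 0)// subr0.
Qed.

End ComplexExponential.

Section QuadraticRemainder.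

Lemma quadratic_remainder_differentiable (K : numFieldType) (V W : normedModType K)
    (f : V -> W) (L : {linear V -> W}) (x : V) (C : K) :
  0 <= C -> (forall h, `|L h| <= C * `|h|) ->
  (forall h, `|h| <= 1 -> `|f (h + x) - f x - L h| <= C * `|h| ^+ 2) ->
  differentiable f x.
Proof.
move=> C0 LC fL.
have C1 : 0 < C + 1 by rewrite ltr_wpDl.
have cL : continuous L.
  apply: continuousfor0_continuous; apply/cvgrPdist_lt => e e0.
  have eC : 0 < e / (C + 1) by rewrite divr_gt0.
  have := nbhsx_ballx (0 : V) _ eC; apply: filterS => h.
  rewrite -ball_normE /ball_/= sub0r normrN linear0 sub0r normrN.
  rewrite ltr_pdivlMr// mulrC => h_lt; apply: le_lt_trans (LC h) _.
  by apply: le_lt_trans h_lt; rewrite ler_wpM2r// lerDl.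
have fE : f \o shift x = cst (f x) + L +o_ (0 : V) id.
  apply/eqaddoP => e e0.
  have eC : 0 < e / (C + 1) by rewrite divr_gt0.
  have := nbhsx_ballx (0 : V) _ eC; have := nbhsx_ballx (0 : V) _ (@ltr01 K).
  apply: filterS2 => h; rewrite -ball_normE /ball_/= sub0r normrN => h1 he.
  have -> : (f \o shift x - (cst (f x) + L)) h = f (h + x) - f x - L h.
    by rewrite !fctE/= opprD addrA.
  apply: le_trans (fL h (ltW h1)) _; rewrite expr2 mulrA ler_wpM2r//.
  apply: (@le_trans _ _ ((C + 1) * `|h|)); first by rewrite ler_wpM2r// lerDl.
  by rewrite mulrC -ler_pdivlMr// ltW.
by apply/diff_locallyP; rewrite (diff_unique cL fE).
Qed.

End QuadraticRemainder.

Section StftEntire.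
Variables (R : realType) (n : nat).
Local Notation mu := (lebesgue_tuple R n).
Local Notation tau := ((2 * pi)%:C%C * 'i%C).

Lemma entry_le_mx_norm (K : numDomainType) (h : 'rV[K]_n) i : `|h 0 i| <= `|h|.
Proof.
rewrite [leRHS]mx_normE -[leLHS]nngE num_le.
exact: (le_bigmax _ (fun ij : 'I_1 * 'I_n => `|h ij.1 ij.2|%:nng) (0, i)).
Qed.

Lemma normc_cdot (h : 'rV[R[i]]_n) (t : 'rV[R]_n) (r : R) :
  (forall i, normc (h 0 i) <= r) -> normc (cdot h t) <= r * l1norm t.
Proof.
move=> hr; apply: le_trans (normc_sum _ _) _; rewrite /l1norm mulr_sumr.
by apply: ler_sum => i _; rewrite normcM normc_real ler_wpM2r.
Qed.

Lemma cdot_linl (a : R[i]) (h g : 'rV[R[i]]_n) (t : 'rV[R]_n) :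
  cdot (a *: h + g) t = a * cdot h t + cdot g t.
Proof.
rewrite /cdot mulr_sumr -big_split; apply: eq_bigr => i _ /=.
by rewrite !mxE mulrDl mulrA.
Qed.

Lemma stft_entire (psi phi : 'rV[R]_n -> R[i]) x : rapid phi -> rapid psi ->
  entire (fun z => stft psi phi x z).
Proof.
move=> rphi rpsi z.
(* The rate 12 leaves exp (- 2 |t|) after absorbing the Taylor remainder: for an
   increment of norm at most 1, |w| <= 8 |t| and |w|^2 exp |w| is at most
   64 exp (10 |t|). *)
have [c c0 Gc] := stft_integrand_exp 12 x z rphi rpsi.
pose G := stft_integrand psi phi x z.
pose w (h : 'rV[R[i]]_n) t := - tau * cdot h t.
pose L h := cintegral mu (fun s => G (row_of_tuple s) * w h (row_of_tuple s)).
have mG := cmeasurable_stft_integrand x z (rapid_continuous rphi) (rapid_continuous rpsi).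
have mw h : cmeasurable (fun s : Rtuple R n => w h (row_of_tuple s)).
  apply: cmeasurableM; first exact: cmeasurable_cst.
  apply: cmeasurable_sum => i; apply: cmeasurableM; first exact: cmeasurable_cst.
  by apply: cmeasurable_real; under eq_fun do rewrite mxE; exact: measurable_tnth.
have wr (h : 'rV[R[i]]_n) (r : R) (t : 'rV[R]_n) :
    (forall i, normc (h 0 i) <= r) -> normc (w h t) <= 8 * r * l1norm t.
  move=> hr; rewrite /w normcM normcN normc_tau -mulrA.
  apply: ler_pM; rewrite ?normc_ge0 ?mulr_ge0 ?pi_ge0 ?two_pi_le8//.
  exact: normc_cdot.
have l1exp (t : 'rV[R]_n) : l1norm t <= expR (l1norm t).
  by apply: le_trans (expR_ge1Dx _); rewrite lerDr.
have Lbound (h : 'rV[R[i]]_n) (r : R) : (forall i, normc (h 0 i) <= r) -> 0 <= r ->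
    cintegrable mu (fun s => G (row_of_tuple s) * w h (row_of_tuple s)) /\
    normc (L h) <= 2 * pi ^+ n * (8 * c * r).
  move=> hr r0; apply: exp_decay_cintegrable; first exact: cmeasurableM.
  move=> s; set t := row_of_tuple s; rewrite (normcM (G t)).
  apply: le_trans (ler_pM (normc_ge0 _) (normc_ge0 _) (Gc t) (wr h r t hr)) _.
  apply: (@le_trans _ _ (8 * c * r * (expR (- (12 * l1norm t)) * expR (l1norm t)))).
    rewrite [leLHS](_ : _ = 8 * c * r * (expR (- (12 * l1norm t)) * l1norm t)); last by ring.
    by rewrite ler_wpM2l ?mulr_ge0// ler_wpM2l ?expR_ge0.
  rewrite -expRD ler_wpM2l ?mulr_ge0// ler_expR.
  by have := l1norm_ge0 t; lra.
have normh (h : 'rV[R[i]]_n) : exists2 r : R, 0 <= r & `|h| = (r%:C)%C.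
  have := normr_ge0 h; case: (`|h|) => a b; rewrite lecE/= => /andP[/eqP -> a0].
  by exists a.
have entryh (h : 'rV[R[i]]_n) (r : R) : `|h| = (r%:C)%C -> forall i, normc (h 0 i) <= r.
  by move=> hr i; have := entry_le_mx_norm h i; rewrite hr normr_normc lecR.
have Gw h : cintegrable mu (fun s => G (row_of_tuple s) * w h (row_of_tuple s)).
  by have [r r0 hr] := normh h; exact: (Lbound h r (entryh _ _ hr) r0).1.
have Llin : linear L.
  move=> a h g; rewrite /L -[RHS]/(a * _ + _) -cintegralZ// -cintegralD//; last first.
    exact: cintegrableZ.
  by congr cintegral; apply/funext => s; rewrite /w cdot_linl; ring.
pose LL : {linear 'rV[R[i]]_n -> R[i]} :=
  HB.pack L (GRing.isLinear.Build _ _ _ _ L Llin).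
(* The constant 4 * 8 ^ 2 of the Taylor remainder, since |w| <= 8 |h| |t|. *)
have [d d0 dE] : exists2 d : R, 0 <= d & d = 256 by exists 256.
pose C := 2 * pi ^+ n * (d * c) : R.
have C0 : 0 <= C by rewrite !mulr_ge0// exprn_ge0// pi_ge0.
apply: (@quadratic_remainder_differentiable _ _ _ _ LL z (C%:C)%C).
- by rewrite lecR.
- move=> h; have [r r0 hr] := normh h.
  rewrite hr -rmorphM/= normr_normc lecR.
  apply: le_trans (Lbound h r (entryh _ _ hr) r0).2 _.
  rewrite /C -[leRHS]mulrA ler_wpM2l ?mulr_ge0 ?exprn_ge0 ?pi_ge0//.
  by rewrite ler_wpM2r// ler_wpM2r// dE ler_nat.
move=> h; have [r r0 hr] := normh h; rewrite hr -rmorphXn -rmorphM/= normr_normc !lecR => r1.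
have zh : stft psi phi x (h + z) - stft psi phi x z - L h =
    cintegral mu (fun s => G (row_of_tuple s) *
      (cexp (w h (row_of_tuple s)) - 1 - w h (row_of_tuple s))).
  rewrite /stft -cintegralN; last exact: stft_cintegrable.
  rewrite -cintegralD; last 2 first.
  - exact: stft_cintegrable.
  - by apply: cintegrableN; exact: stft_cintegrable.
  rewrite /L -cintegralN// -cintegralD; last 2 first.
  - by apply: cintegrableD; [|apply: cintegrableN]; exact: stft_cintegrable.
  - exact: cintegrableN.
  congr cintegral; apply/funext => s; set t := row_of_tuple s.
  rewrite [stft_integrand _ _ _ (h + z) _](_ : _ = G t * cexp (w h t)); last first.
    rewrite /G /stft_integrand -[RHS]mulrA -cexpD; congr (_ * cexp _).
    have -> : cdot (h + z) t = cdot h t + cdot z t.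
      by rewrite -{1}[h]scale1r cdot_linl mul1r.
    by rewrite /w mulNr mulrDr opprD addrC.
  by rewrite -/(G t); ring.
have mrem : cmeasurable (fun s => G (row_of_tuple s) *
      (cexp (w h (row_of_tuple s)) - 1 - w h (row_of_tuple s))).
  apply: cmeasurableM => //.
  under eq_fun do rewrite -addrA -opprD -mulN1r.
  apply: cmeasurableD; first exact: cmeasurable_cexp.
  apply: cmeasurableM; first exact: cmeasurable_cst.
  by apply: cmeasurableD => //; exact: cmeasurable_cst.
rewrite zh.
apply: le_trans (exp_decay_cintegrable (c := d * c * r ^+ 2) mrem _).2 _;
  last first.
  by rewrite /C; lra.
move=> s; set t := row_of_tuple s; rewrite (normcM (G t)).
have l0 := l1norm_ge0 t; have wht := wr h r t (entryh _ _ hr).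
have wht8 : normc (w h t) <= 8 * l1norm t.
  by apply: le_trans wht _; rewrite ler_wpM2r// ler_piMr.
have T : normc (cexp (w h t) - 1 - w h t) <=
    d * r ^+ 2 * expR (10 * l1norm t).
  apply: le_trans (normc_cexp_taylor _) _.
  apply: (@le_trans _ _ (4 * ((8 * r * l1norm t) ^+ 2 * expR (8 * l1norm t)))).
    rewrite ler_wpM2l// ler_pM ?expR_ge0 ?exprn_ge0 ?normc_ge0//.
      by rewrite lerXn2r ?nnegrE ?normc_ge0 ?mulr_ge0.
    by rewrite ler_expR.
  apply: (@le_trans _ _ (d * r ^+ 2 * (expR (l1norm t) ^+ 2 * expR (8 * l1norm t)))).
    rewrite [leLHS](_ : _ = d * r ^+ 2 * (l1norm t ^+ 2 * expR (8 * l1norm t)));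
      last by rewrite dE; ring.
    rewrite ler_wpM2l ?mulr_ge0 ?exprn_ge0// ler_wpM2r ?expR_ge0//.
    by rewrite lerXn2r ?nnegrE ?expR_ge0.
  rewrite ler_wpM2l ?mulr_ge0 ?exprn_ge0// -expRM_natl -expRD ler_expR; lra.
apply: le_trans (ler_pM (normc_ge0 _) (normc_ge0 _) (Gc t) T) _.
rewrite [leLHS](_ : _ = d * c * r ^+ 2 *
  (expR (- (12 * l1norm t)) * expR (10 * l1norm t))); last by ring.
rewrite -expRD ler_wpM2l ?mulr_ge0 ?exprn_ge0// ler_expR; lra.
Qed.

End StftEntire.

(** * Norms of the short-time Fourier transform *)

Section StftNorms.
Variables (R : realType) (n : nat).
Implicit Types (phi psi : 'rV[R]_n -> R[i]) (z : 'rV[R[i]]_n).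

Lemma weight_power (k : nat) z :
  (1 + cenorm z ^+ 2) `^ (k%:R / 2) = Num.sqrt (1 + cenorm z ^+ 2) ^+ k.
Proof.
have c0 : 0 <= 1 + cenorm z ^+ 2 by rewrite addr_ge0// sqr_ge0.
by rewrite mulrC powRrM powR12_sqrt// powR_mulrn// sqrtr_ge0.
Qed.

Lemma weight_root_ge1 z : 1 <= Num.sqrt (1 + cenorm z ^+ 2).
Proof. by rewrite -{1}(@sqrtr1 R) ler_sqrt ?lerDl ?addr_ge0 ?sqr_ge0. Qed.

Lemma cenormE z : cenorm z = enorm (\row_j normc (z 0 j)).
Proof. by congr Num.sqrt; apply: eq_bigr => i _; rewrite mxE. Qed.

Lemma normc_entry_le_root z j : normc (z 0 j) <= Num.sqrt (1 + cenorm z ^+ 2).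
Proof.
apply: (@le_trans _ _ (cenorm z)).
  have := entry_le_enorm (\row_j normc (z 0 j)) j.
  by rewrite cenormE mxE ger0_norm ?normc_ge0.
rewrite -[leLHS]ger0_norm ?sqrtr_ge0// -sqrtr_sqr.
by rewrite ler_sqrt ?lerDr ?addr_ge0 ?sqr_ge0.
Qed.

Lemma weight_root_le z :
  Num.sqrt (1 + cenorm z ^+ 2) <= 1 + \sum_j normc (z 0 j).
Proof.
have S0 : 0 <= \sum_j normc (z 0 j) by apply: sumr_ge0 => j _; exact: normc_ge0.
have cS : cenorm z <= \sum_j normc (z 0 j).
  rewrite cenormE; apply: le_trans (enorm_le_l1norm _) _.
  by apply: ler_sum => j _; rewrite mxE ger0_norm ?normc_ge0.
rewrite -[leRHS]ger0_norm ?addr_ge0// -sqrtr_sqr ler_sqrt ?sqr_ge0//.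
have : cenorm z ^+ 2 <= (\sum_j normc (z 0 j)) ^+ 2.
  by rewrite lerXn2r ?nnegrE ?sqrtr_ge0.
by rewrite sqrrD expr1n; lra.
Qed.

(** The weight is comparable with the largest of [1, |z_1|^k, ..., |z_n|^k]. *)
Lemma weighted_le (k : nat) z (X D : R) : 0 <= X -> X <= D ->
  (forall j, normc (z 0 j) ^+ k * X <= D) ->
  (1 + cenorm z ^+ 2) `^ (k%:R / 2) * X <= n.+1%:R ^+ k * D.
Proof.
move=> X0 XD zD; rewrite weight_power.
have [b [b1 zb bD]] : exists b, [/\ 1 <= b, forall j, normc (z 0 j) <= b &
    b ^+ k * X <= D].
  have [j0 _|/(_ _)/negP noj] := pickP (fun j : 'I_n => 1 <= normc (z 0 j)).
    pose j := [arg max_(j > j0) normc (z 0 j)]%O.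
    have jmax i : normc (z 0 i) <= normc (z 0 j).
      by rewrite /j; case: arg_maxP => // m _; exact.
    exists (Num.max 1 (normc (z 0 j))); split.
    - by rewrite le_max lexx.
    - by move=> i; rewrite le_max jmax orbT.
    - by rewrite /Num.max; case: ifP => _; [exact: zD|rewrite expr1n mul1r].
  exists 1; split => //; last by rewrite expr1n mul1r.
  by move=> j; have /negP := noj j; rewrite -ltNge => /ltW.
apply: (@le_trans _ _ ((n.+1%:R * b) ^+ k * X)); last first.
  by rewrite exprMn -mulrA ler_wpM2l// exprn_ge0.
have b0 : 0 <= b by rewrite (le_trans ler01).
apply: ler_wpM2r => //; apply: lerXn2r; rewrite ?nnegrE ?sqrtr_ge0 ?mulr_ge0//.
apply: le_trans (weight_root_le z) _.
rewrite -natr1 mulrDl mul1r addrC lerD// -[n in n%:R]card_ord -sum1_card.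
by rewrite natr_sum mulr_suml; apply: ler_sum => i _; rewrite mul1r.
Qed.

Lemma normc_sign m : normc ((-1) ^+ m : R[i]) = 1.
Proof. by apply: complexI; rewrite -normr_normc normrX normrN1 expr1n. Qed.

(** The decay rate [9 k + 2] of phi is [k + 8 N + 2] on the strip of width
    [N = k]; psi is differentiated [k] times in x and [k] times in the
    integrations by parts. *)
Lemma stft_KU_norm (k : nat) (A B : R) phi psi : rapid phi -> rapid psi ->
  decays (9 * k + 2) k A phi -> decays k (k + k) B psi ->
  (KU_norm k (stft psi phi) <=
   (n.+1%:R ^+ k * (2 ^+ k * (2 * pi ^+ n * (A * B))))%:E)%E.
Proof.
move=> rphi rpsi phiA psiB; apply: ge_ereal_sup => _ [[[x z] a] /= [zk ak] <-].
rewrite lee_fin mpartial_dword dword_stft//.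
have -> : normc ((-1) ^+ size (word_of a) * stft (dword (word_of a) psi) phi x z) =
    normc (stft (dword (word_of a) psi) phi x z).
  by rewrite (normcM _ (stft _ _ _ _)) normc_sign mul1r.
have rpsi' := rapid_dword (word_of a) rpsi.
have psiB' : decays k k B (dword (word_of a) psi).
  by apply: decays_dword psiB _; rewrite leq_add2r size_word_of.
have A0 := decays_ge0 phiA; have B0 := decays_ge0 psiB.
have KN : (k + 8 * k + 2 <= 9 * k + 2)%N by rewrite -[X in (X + _ + _)%N]mul1n -mulnDl.
have J0 : 0 <= 2 * pi ^+ n * (A * B) by rewrite !mulr_ge0// exprn_ge0// pi_ge0.
rewrite mulrAC mulrC; apply: weighted_le.
- by rewrite mulr_ge0 ?expR_ge0 ?normc_ge0.
- apply: (@le_trans _ _ (2 * pi ^+ n * (A * B))); last first.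
    by rewrite ler_peMl// exprn_ege1// ler1n.
  have := (stft_bounded x (rapid_continuous rphi) (rapid_continuous rpsi') KN
    (decays_sub (leqnn _) (leq0n _) phiA) (decays_sub (leqnn _) (leq0n _) psiB') zk).2.
  apply: le_trans; rewrite ler_wpM2r ?normc_ge0// ler_expR ler_wpM2l//.
  exact: enorm_le_l1norm.
- move=> j; have := stft_power_bounded x j rphi rpsi' KN phiA psiB' zk.
  apply: le_trans; rewrite mulrCA ler_wpM2r ?mulr_ge0 ?exprn_ge0 ?normc_ge0//.
  by rewrite ler_expR ler_wpM2l// enorm_le_l1norm.
Qed.

Lemma stft_KU phi psi : rapid phi -> rapid psi -> stft psi phi \in @KU_pred R n.
Proof.
move=> rphi rpsi; rewrite inE; split.
- by move=> z; exact: smooth_stft.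
- by move=> x; exact: stft_entire.
- move=> k; have [A phiA] := rphi.2 (9 * k + 2)%N k.
  have [B psiB] := rpsi.2 k (k + k)%N.
  exact: le_lt_trans (stft_KU_norm rphi rpsi phiA psiB) (ltry _).
Qed.

End StftNorms.

(** * The adjoint transform *)

Section AdjointStft.
Variables (R : realType) (n : nat).
Implicit Types (F : 'rV[R]_n -> 'rV[R]_n -> R[i]) (psi : 'rV[R]_n -> R[i]).
Implicit Types (t x xi : 'rV[R]_n).
Local Notation mu := (lebesgue_tuple R n).
Local Notation nu := (lebesgue_tuple R n \x lebesgue_tuple R n)%E.
Local Notation tau := ((2 * pi)%:C%C * 'i%C).

Definition synth_integrand psi F t x xi : R[i] :=
  F x xi * psi (t - x) * cexp (tau * cdot (complex_row xi) t).

(** The adjoint transform of a symbol given on real frequencies only: a class of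
    symbols without holomorphy is stable under multiplication by the frequency
    for trivial reasons. *)
Definition synth psi F t : R[i] := cintegral nu
  (fun s => synth_integrand psi F t (row_of_tuple s.1) (row_of_tuple s.2)).

Definition symbol_decays (a b : nat) (A : R) F : Prop := forall x xi,
  expR (a%:R * l1norm x) * (1 + l1norm xi) ^+ b * normc (F x xi) <= A.

Definition rapid_symbol F :=
  cmeasurable (fun s : Rtuple R n * Rtuple R n =>
    F (row_of_tuple s.1) (row_of_tuple s.2)) /\
  forall a b, exists A, symbol_decays a b A F.

Definition mulxi i F x xi : R[i] := tau * ((xi 0 i)%:C)%C * F x xi.

Let weight2 (s : Rtuple R n * Rtuple R n) : R :=
  rational_weight (row_of_tuple s.1) * rational_weight (row_of_tuple s.2).

Definition weight2_mass : R := \int[nu]_s weight2 s.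

Lemma weight2_mass_ge0 : 0 <= weight2_mass.
Proof.
by apply: Rintegral_ge0 => s _; rewrite mulr_ge0// rational_weight_ge0.
Qed.

Lemma integrable_weight2M (c : R) :
  nu.-integrable setT (EFin \o (fun s => c * weight2 s)).
Proof.
rewrite /comp; under eq_fun do rewrite EFinM.
by apply: integrableZl => //; exact: integrable_rational_weight_prod.
Qed.

Lemma weight2_cintegrable (f : Rtuple R n * Rtuple R n -> R[i]) (c : R) :
  cmeasurable f -> (forall s, normc (f s) <= c * weight2 s) ->
  cintegrable nu f /\ normc (cintegral nu f) <= 2 * weight2_mass * c.
Proof.
move=> mf fc; split; first exact: (le_cintegrable mf (integrable_weight2M c) fc).
apply: le_trans (le_normc_cintegral mf (integrable_weight2M c) fc) _.
rewrite RintegralZl//; last exact: integrable_rational_weight_prod.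
by rewrite mulrCA mulrC.
Qed.

(** Two powers of [1 + |xi|] are spent on each coordinate. *)
Lemma inv_power_le_rational_weight xi :
  ((1 + l1norm xi) ^+ (2 * n))^-1 <= rational_weight xi.
Proof.
have l0 := l1norm_ge0 xi.
rewrite /rational_weight prodfV lef_pV2 ?posrE; last 2 first.
- by rewrite exprn_gt0// ltr_wpDr.
- by apply: prodr_gt0 => i _; rewrite (lt_le_trans ltr01).
have -> : (1 + l1norm xi) ^+ (2 * n) = \prod_(i < n) (1 + l1norm xi) ^+ 2.
  by rewrite prodr_const card_ord exprM.
apply: ler_prod => i _.
rewrite (le_trans ler01)//= /oneDsqr -[xi 0 i ^+ 2]real_normK ?num_real//.
have xl := entry_le_l1norm xi i; have x0 := normr_ge0 (xi 0 i).
have : `|xi 0 i| ^+ 2 <= l1norm xi ^+ 2 by rewrite lerXn2r ?nnegrE.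
by rewrite sqrrD expr1n; lra.
Qed.

Lemma normc_unit_kernel xi t : normc (cexp (tau * cdot (complex_row xi) t)) = 1.
Proof.
rewrite normc_cexp [complex.Re _](_ : _ = 0) ?expR0// !ReM !ImM Im_cdot.
rewrite big1 /= => [|i _]; first by ring.
by rewrite mxE/= mul0r.
Qed.

Lemma cmeasurable_synth_integrand psi F t : rapid_symbol F -> continuous psi ->
  cmeasurable (fun s : Rtuple R n * Rtuple R n =>
    synth_integrand psi F t (row_of_tuple s.1) (row_of_tuple s.2)).
Proof.
move=> [mF _] cpsi; apply: cmeasurableM.
  apply: cmeasurableM => //.
  have cpsi' : continuous (fun x => psi (t - x)) by exact: continuous_reflect.
  have [mr mi] := continuous_cmeasurable_row cpsi'.
  split; first exact: (measurableT_comp mr measurable_fst).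
  exact: (measurableT_comp mi measurable_fst).
apply: cmeasurable_cexp; apply: cmeasurableM; first exact: cmeasurable_cst.
apply: cmeasurable_sum => i; apply: cmeasurableM; last exact: cmeasurable_cst.
under eq_fun do rewrite !mxE; apply: cmeasurable_real.
exact: (measurableT_comp (measurable_tnth i) measurable_snd).
Qed.

Lemma synth_integrand_decays k A B psi F t x xi :
  symbol_decays (k + 2) (2 * n) A F -> decays k 0 B psi ->
  expR (k%:R * l1norm t) * normc (synth_integrand psi F t x xi) <=
  A * B * (rational_weight x * rational_weight xi).
Proof.
move=> FA psiB; rewrite /synth_integrand (normcM (F x xi * _)) normc_unit_kernel.
rewrite mulr1 (normcM (F x xi)).
have l1 := l1norm_ge0 xi.
have w0 : 0 < (1 + l1norm xi) ^+ (2 * n) by rewrite exprn_gt0// ltr_wpDr.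
have p1 : normc (F x xi) <=
    A * (expR (- ((k + 2)%:R * l1norm x)) * ((1 + l1norm xi) ^+ (2 * n))^-1).
  rewrite expRN -invfM ler_pdivlMr ?mulr_gt0 ?expR_gt0// mulrC.
  exact: FA.
have p2 : normc (psi (t - x)) <= B * expR (- (k%:R * l1norm (t - x))).
  exact: (decays_le (t - x) psiB (w := [::])).
have B0 := decays_ge0 psiB.
have A0 : 0 <= A.
  have := le_trans (normc_ge0 _) p1; rewrite pmulr_lge0//.
  by rewrite mulr_gt0 ?expR_gt0// invr_gt0.
apply: (@le_trans _ _ (expR (k%:R * l1norm t) *
  (A * (expR (- ((k + 2)%:R * l1norm x)) * ((1 + l1norm xi) ^+ (2 * n))^-1) *
  (B * expR (- (k%:R * l1norm (t - x))))))).
  by rewrite ler_wpM2l ?expR_ge0// ler_pM ?normc_ge0.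
rewrite [leLHS](_ : _ = A * B * (expR (k%:R * l1norm t - (k + 2)%:R * l1norm x -
  k%:R * l1norm (t - x)) * ((1 + l1norm xi) ^+ (2 * n))^-1)); last first.
  by rewrite !expRD; ring.
apply: ler_wpM2l; first exact: mulr_ge0.
apply: ler_pM; rewrite ?expR_ge0 ?invr_ge0 ?(ltW w0) ?inv_power_le_rational_weight//.
apply: le_trans (exp_le_rational_weight x); rewrite ler_expR natrD.
have tx : l1norm t <= l1norm (t - x) + l1norm x by rewrite -{1}(subrK x t) l1normD.
have : k%:R * l1norm t <= k%:R * (l1norm (t - x) + l1norm x) by rewrite ler_wpM2l.
lra.
Qed.

Lemma synth_bounded k A B psi F t : rapid_symbol F -> continuous psi ->
  symbol_decays (k + 2) (2 * n) A F -> decays k 0 B psi ->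
  cintegrable nu (fun s =>
    synth_integrand psi F t (row_of_tuple s.1) (row_of_tuple s.2)) /\
  expR (k%:R * l1norm t) * normc (synth psi F t) <= 2 * weight2_mass * (A * B).
Proof.
move=> rF cpsi FA psiB.
have D (s : Rtuple R n * Rtuple R n) :
    normc (synth_integrand psi F t (row_of_tuple s.1) (row_of_tuple s.2)) <=
    expR (- (k%:R * l1norm t)) * (A * B) * weight2 s.
  rewrite -mulrA expRN ler_pdivlMl ?expR_gt0//.
  exact: synth_integrand_decays.
have [int le] := weight2_cintegrable (cmeasurable_synth_integrand t rF cpsi) D.
split => //; rewrite -ler_pdivlMl ?expR_gt0// -expRN.
by apply: le_trans le _; rewrite mulrCA.
Qed.

Lemma synth_cintegrable psi F t : rapid_symbol F -> rapid psi ->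
  cintegrable nu (fun s =>
    synth_integrand psi F t (row_of_tuple s.1) (row_of_tuple s.2)).
Proof.
move=> rF rpsi; have [A FA] := rF.2 (0 + 2)%N (2 * n)%N.
have [B psiB] := rpsi.2 0%N 0%N.
exact: (synth_bounded t rF (rapid_continuous rpsi) FA psiB).1.
Qed.

Lemma symbol_decays_mulxi i a b A F :
  symbol_decays a b.+1 A F -> symbol_decays a b (8 * A) (mulxi i F).
Proof.
move=> FA x xi; apply: le_trans (ler_wpM2l _ (FA x xi)) => //.
rewrite /mulxi (normcM (tau * _)) (normcM tau) normc_tau normc_real.
rewrite exprSr [leRHS](_ : _ = expR (a%:R * l1norm x) * (1 + l1norm xi) ^+ b *
  (8 * (1 + l1norm xi) * normc (F x xi))); last by ring.
have l1 := l1norm_ge0 xi.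
rewrite ler_wpM2l ?mulr_ge0 ?expR_ge0 ?exprn_ge0 ?addr_ge0//.
rewrite ler_wpM2r ?normc_ge0// ler_pM ?mulr_ge0 ?pi_ge0 ?two_pi_le8//.
by rewrite (le_trans (entry_le_l1norm xi i))// lerDr.
Qed.

Lemma rapid_mulxi i F : rapid_symbol F -> rapid_symbol (mulxi i F).
Proof.
move=> [mF dF]; split.
  apply: cmeasurableM => //; apply: cmeasurableM; first exact: cmeasurable_cst.
  apply: cmeasurable_real; under eq_fun do rewrite mxE.
  exact: (measurableT_comp (measurable_tnth i) measurable_snd).
move=> a b; have [A FA] := dF a b.+1.
by exists (8 * A); exact: symbol_decays_mulxi.
Qed.

(** The product rule under the integral: a derivative falls either on psi or on
    the character, where it multiplies the symbol by [2 pi i xi_i]. *)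
Lemma is_cpartial_synth psi F i t : rapid_symbol F -> rapid psi ->
  is_cpartial i (synth psi F) t
    (synth (cpartial i psi) F t + synth psi (mulxi i F) t).
Proof.
move=> rF rpsi; have rdpsi := rapid_cpartial i rpsi; have rFi := rapid_mulxi i rF.
have [A FA] := rF.2 (0 + 2)%N (2 * n)%N; have [B psiB] := rpsi.2 0%N 0%N.
have [A' FiA] := rFi.2 (0 + 2)%N (2 * n)%N; have [B' dpsiB] := rdpsi.2 0%N 0%N.
rewrite /synth -cintegralD; [|exact: synth_cintegrable|exact: synth_cintegrable].
apply: (is_cpartial_cintegral
  (f := fun y s => synth_integrand psi F y (row_of_tuple s.1) (row_of_tuple s.2))
  (f' := fun y s =>
    synth_integrand (cpartial i psi) F y (row_of_tuple s.1) (row_of_tuple s.2) +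
    synth_integrand psi (mulxi i F) y (row_of_tuple s.1) (row_of_tuple s.2))
  (M := fun s => (A * B' + A' * B) * weight2 s)).
- by move=> y; exact: synth_cintegrable.
- move=> y s; rewrite /synth_integrand /mulxi.
  set x := row_of_tuple s.1; set xi := row_of_tuple s.2.
  have dpsi := is_cpartialZ (F x xi)
    (is_cpartial_translate (rapid_is_cpartial i (y - x) rpsi)).
  have := is_cpartialM dpsi (is_cpartial_cexp i tau (complex_row xi) y).
  by congr is_cpartial; rewrite /complex_row [in LHS]mxE; ring.
- exact: integrable_weight2M.
move=> h s _; apply: le_trans (le_normcD _ _) _; rewrite mulrDl.
have b1 := synth_integrand_decays (t + h *: 'e_i) (row_of_tuple s.1)
  (row_of_tuple s.2) FA dpsiB.
have b2 := synth_integrand_decays (t + h *: 'e_i) (row_of_tuple s.1)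
  (row_of_tuple s.2) FiA psiB.
by move: b1 b2; rewrite mul0r expR0 !mul1r => b1 b2; exact: lerD.
Qed.

Lemma cpartial_synth psi F i : rapid_symbol F -> rapid psi ->
  cpartial i (synth psi F) =
  1 *: synth (cpartial i psi) F + synth psi (mulxi i F).
Proof.
move=> rF rpsi; apply/funext => t; rewrite scale1r.
exact: is_cpartialE (is_cpartial_synth i t rF rpsi).
Qed.

Lemma smooth_synth psi F : rapid_symbol F -> rapid psi -> smooth (synth psi F).
Proof.
move=> + + r; elim: r psi F => [|r IHr] psi F rF rpsi /=.
  apply: (bounded_cpartials_continuous (fun i t => is_cpartial_synth i t rF rpsi)).
  move=> i; have rdpsi := rapid_cpartial i rpsi; have rFi := rapid_mulxi i rF.
  have [A FA] := rF.2 (0 + 2)%N (2 * n)%N; have [B psiB] := rpsi.2 0%N 0%N.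
  have [A' FiA] := rFi.2 (0 + 2)%N (2 * n)%N; have [B' dpsiB] := rdpsi.2 0%N 0%N.
  exists (2 * weight2_mass * (A * B') + 2 * weight2_mass * (A' * B)) => t.
  apply: le_trans (le_normcD _ _) _.
  have [_ b1] := synth_bounded t rF (rapid_continuous rdpsi) FA dpsiB.
  have [_ b2] := synth_bounded t rFi (rapid_continuous rpsi) FiA psiB.
  by move: b1 b2; rewrite mul0r expR0 !mul1r => b1 b2; exact: lerD.
split; first by have := IHr psi F rF rpsi; case: (r) => [|q []].
move=> i; split.
  by move=> t; exact: is_cpartial_cderivable (is_cpartial_synth i t rF rpsi).
rewrite cpartial_synth//; apply: classC_lin.
  by apply: IHr => //; exact: rapid_cpartial.
by apply: IHr => //; exact: rapid_mulxi.
Qed.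

(** Every derivative doubles the number of terms, and those in which it falls on
    the character cost one more power of the frequency and a factor [2 pi]. *)
Lemma synth_dword_bounded w k A B psi F t : rapid_symbol F -> rapid psi ->
  symbol_decays (k + 2) (2 * n + size w) A F -> decays k (size w) B psi ->
  expR (k%:R * l1norm t) * normc (dword w (synth psi F) t) <=
  9 ^+ size w * (2 * weight2_mass * (A * B)).
Proof.
elim/last_ind: w psi F A => [|w i IHw] psi F A rF rpsi FA psiB.
  rewrite mul1r; rewrite addn0 in FA.
  exact: (synth_bounded t rF (rapid_continuous rpsi) FA psiB).2.
rewrite size_rcons in FA psiB *; rewrite (addnS (2 * n)) in FA.
have rdpsi := rapid_cpartial i rpsi; have rFi := rapid_mulxi i rF.
have FA' : symbol_decays (k + 2) (2 * n + size w) A F.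
  move=> x xi; apply: le_trans (FA x xi).
  apply: ler_wpM2r; first exact: normc_ge0.
  apply: ler_wpM2l; first exact: expR_ge0.
  by apply: ler_weXn2l; [rewrite lerDl l1norm_ge0|exact: leqnSn].
have IH1 := IHw _ _ _ rF rdpsi FA' (decays_cpartial i psiB).
have IH2 := IHw _ _ _ rFi rpsi (symbol_decays_mulxi i FA)
  (decays_sub (leqnn k) (leqnSn _) psiB).
rewrite dword_rcons cpartial_synth// dword_lin; last 2 first.
- exact: smooth_synth.
- exact: smooth_synth.
rewrite scale1r; apply: (@le_trans _ _ (expR (k%:R * l1norm t) *
  (normc (dword w (synth (cpartial i psi) F) t) +
   normc (dword w (synth psi (mulxi i F)) t)))).
  by rewrite ler_wpM2l ?expR_ge0//; exact: le_normcD.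
rewrite mulrDr; apply: le_trans (lerD IH1 IH2) _.
rewrite exprSr; lra.
Qed.

End AdjointStft.

(** * Holomorphic functions as symbols of the adjoint transform *)

Lemma ball_continuous (R : realType) (V : pseudoMetricType R)
    (W : pseudoMetricType R[i]) (f : V -> W) :
  (forall x y (e : R), ball x e y -> ball (f x) (e%:C)%C (f y)) -> continuous f.
Proof.
move=> fball x; apply/cvg_ballP => e /pos_complexE[r r0 ->].
by have := nbhsx_ballx x _ r0; apply: filterS => y; exact: fball.
Qed.

Section SymbolOfKU.
Variables (R : realType) (n : nat).
Implicit Types (x xi : 'rV[R]_n) (F : 'rV[R]_n -> 'rV[R[i]]_n -> R[i]).

Lemma continuous_complex_row : continuous (@complex_row R n).
Proof.
apply: ball_continuous => x y e [e0 xy]; split; first by rewrite ltcR.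
move=> i j; have := xy i j; rewrite !mxE /ball/= => xye.
by rewrite -rmorphB/= normr_normc ltcR normc_real.
Qed.

Definition real_symbol F x xi : R[i] := F x (complex_row xi).

(** F is smooth in x for each z and entire in z for each x; no joint continuity
    is assumed, whence Caratheodory's argument. *)
Lemma cmeasurable_real_symbol F :
  (forall z, smooth (F ^~ z)) -> (forall x, entire (F x)) ->
  cmeasurable (fun s : Rtuple R n * Rtuple R n =>
    real_symbol F (row_of_tuple s.1) (row_of_tuple s.2)).
Proof.
move=> sF eF.
have cx z : continuous (F ^~ z) by exact: smooth_continuous.
have cxi x : continuous (real_symbol F x).
  have cF : continuous (F x) by move=> z; exact: differentiable_continuous (eF x z).
  exact: (fun xi => continuous_comp (@continuous_complex_row xi) (cF _)).
split.
  apply: (measurable_fun_caratheodory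
    (f := fun x s => complex.Re (real_symbol F x (row_of_tuple s)))) => [s x|x].
    exact: (cvg_Re (cx _ x)).
  exact: (continuous_cmeasurable_row (cxi x)).1.
apply: (measurable_fun_caratheodory
  (f := fun x s => complex.Im (real_symbol F x (row_of_tuple s)))) => [s x|x].
  exact: (cvg_Im (cx _ x)).
exact: (continuous_cmeasurable_row (cxi x)).2.
Qed.

Lemma KU_norm_ge0 k F : (0 <= KU_norm k F)%E.
Proof.
have : ((expR (k%:R * enorm (0 : 'rV[R]_n)) *
    (1 + cenorm (0 : 'rV[R[i]]_n) ^+ 2) `^ (k%:R / 2) *
    normc (mpartial [ffun=> 0%N] (F ^~ 0) 0))%:E <= KU_norm k F)%E.
  apply: ereal_sup_ubound; exists (0, 0, [ffun=> 0%N]) => //=; split.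
    by move=> i; rewrite mxE/= normr0.
  by rewrite /mdeg big1// => i _; rewrite ffunE.
by apply: le_trans; rewrite lee_fin !mulr_ge0 ?expR_ge0 ?powR_ge0 ?normc_ge0.
Qed.

Lemma KU_norm_homo k k' F : (k <= k')%N -> (KU_norm k F <= KU_norm k' F)%E.
Proof.
move=> kk; apply: ge_ereal_sup => _ [[[x z] a] /= [zk ak] <-].
apply: (@le_trans _ _ (expR (k'%:R * enorm x) *
    (1 + cenorm z ^+ 2) `^ (k'%:R / 2) * normc (mpartial a (F ^~ z) x))%:E).
  rewrite lee_fin; apply: ler_wpM2r; first exact: normc_ge0.
  apply: ler_pM; rewrite ?expR_ge0 ?powR_ge0//.
    by rewrite ler_expR ler_wpM2r ?enorm_ge0// ler_nat.
  by rewrite !weight_power ler_weXn2l ?weight_root_ge1.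
apply: ereal_sup_ubound; exists (x, z, a) => //=; split.
  by move=> i; rewrite (le_trans (zk i))// ler_nat.
exact: leq_trans kk.
Qed.

(** On real frequencies the weight of the norm dominates, up to a constant,
    [1 + |xi|] raised to the same power. *)
Lemma KU_norm_symbol_decays K a b F : (KU_norm K F < +oo)%E ->
  (n * a <= K)%N -> (b <= K)%N ->
  symbol_decays a b (n.+1%:R ^+ b * fine (KU_norm K F)) (real_symbol F).
Proof.
move=> FK naK bK x xi; set z := complex_row xi; rewrite /real_symbol -/z.
have FE : normc (F x z) * (expR (K%:R * enorm x) * Num.sqrt (1 + cenorm z ^+ 2) ^+ K)
    <= fine (KU_norm K F).
  rewrite -lee_fin fineK; last by rewrite ge0_fin_numE// KU_norm_ge0.
  rewrite mulrC -weight_power.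
  have -> : F x z = mpartial [ffun=> 0%N] (F ^~ z) x.
    rewrite mpartial_dword; suff -> : word_of [ffun=> 0%N] = [::] :> seq 'I_n by [].
    by apply/eqP; rewrite -size_eq0 size_word_of /mdeg big1// => i _; rewrite ffunE.
  apply: ereal_sup_ubound; exists (x, z, [ffun=> 0%N]) => //=; split.
    by move=> i; rewrite mxE/= normr0.
  by rewrite /mdeg big1// => i _; rewrite ffunE.
have r1 := weight_root_ge1 z; set r := Num.sqrt _ in r1 FE *.
have r0 : 0 <= r by rewrite (le_trans ler01).
have l1r : 1 + l1norm xi <= n.+1%:R * r.
  rewrite -natr1 mulrDl mul1r addrC lerD// -[n in n%:R]card_ord -sum1_card.
  rewrite natr_sum mulr_suml; apply: ler_sum => i _; rewrite mul1r.
  by have := normc_entry_le_root z i; rewrite mxE normc_real.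
apply: (@le_trans _ _ (expR (K%:R * enorm x) * (n.+1%:R ^+ b * r ^+ K) *
    normc (F x z))); last first.
  rewrite [leLHS](_ : _ = n.+1%:R ^+ b *
    (normc (F x z) * (expR (K%:R * enorm x) * r ^+ K))); last by ring.
  by rewrite ler_wpM2l// exprn_ge0.
have l0 := l1norm_ge0 xi.
apply: ler_wpM2r; first exact: normc_ge0.
apply: ler_pM; rewrite ?expR_ge0 ?exprn_ge0 ?addr_ge0//.
  rewrite ler_expR; apply: (@le_trans _ _ (a%:R * (n%:R * enorm x))).
    by rewrite ler_wpM2l// l1norm_le_enorm.
  by rewrite mulrA ler_wpM2r ?enorm_ge0// -natrM ler_nat mulnC.
apply: (@le_trans _ _ ((n.+1%:R * r) ^+ b)).
  by rewrite lerXn2r ?nnegrE ?addr_ge0 ?mulr_ge0.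
rewrite exprMn; apply: ler_wpM2l; first by rewrite exprn_ge0.
exact: ler_weXn2l.
Qed.

Lemma KU_rapid_symbol F : F \in @KU_pred R n -> rapid_symbol (real_symbol F).
Proof.
rewrite inE => -[sF eF FK]; split; first exact: cmeasurable_real_symbol.
move=> a b; exists (n.+1%:R ^+ b * fine (KU_norm (n * a + b) F)).
by apply: KU_norm_symbol_decays => //; [exact: leq_addr|exact: leq_addl].
Qed.

Lemma synth_K1_norm (k : nat) (A B : R) G (psi : 'rV[R]_n -> R[i]) :
  rapid_symbol G -> rapid psi ->
  symbol_decays (k + 2) (2 * n + k) A G -> decays k k B psi ->
  (K1_norm k (synth psi G) <= (9 ^+ k * (2 * weight2_mass R n * (A * B)))%:E)%E.
Proof.
move=> rG rpsi GA psiB; apply: decays_K1_norm => w t wk.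
have B0 := decays_ge0 psiB.
have A0 : 0 <= A.
  apply: le_trans (GA 0 0).
  by rewrite !mulr_ge0 ?expR_ge0 ?exprn_ge0 ?normc_ge0// addr_ge0// l1norm_ge0.
have GA' : symbol_decays (k + 2) (2 * n + size w) A G.
  move=> x xi; apply: le_trans (GA x xi).
  apply: ler_wpM2r; first exact: normc_ge0.
  apply: ler_wpM2l; first exact: expR_ge0.
  by apply: ler_weXn2l; [rewrite lerDl l1norm_ge0|rewrite leq_add2l].
apply: le_trans (synth_dword_bounded t rG rpsi GA' (decays_sub (leqnn k) wk psiB)) _.
have M0 := weight2_mass_ge0 R n.
apply: ler_wpM2r; first by rewrite !mulr_ge0.
by apply: ler_weXn2l => //; rewrite ler1n.
Qed.

Lemma synth_K1 G (psi : 'rV[R]_n -> R[i]) :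
  rapid_symbol G -> rapid psi -> synth psi G \in @K1_pred R n.
Proof.
move=> rG rpsi; rewrite inE; split; first exact: smooth_synth.
move=> k; have [A GA] := rG.2 (k + 2)%N (2 * n + k)%N.
have [B psiB] := rpsi.2 k k.
exact: le_lt_trans (synth_K1_norm rG rpsi GA psiB) (ltry _).
Qed.

End SymbolOfKU.

(** * Continuity of bilinear maps *)

Section BilinearContinuity.
Variable R : realType.

(** [B x y - B x' y'] is expanded around (x, y), so that the bound involves only
    norms of the fixed point and of the increments. *)
Lemma bilinear_estimate (U V W : zmodType) (p : nat -> U -> \bar R)
    (q : nat -> V -> \bar R) (r : nat -> W -> \bar R) (B : U -> V -> W) :
  (forall x x' y, B (x - x') y = B x y - B x' y) ->
  (forall x y y', B x (y - y') = B x y - B x y') ->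
  (forall k x y, (r k (x + y)%R <= r k x + r k y)%E) ->
  (forall k x, (r k (- x)%R <= r k x)%E) ->
  (forall k x, exists a : R, (p k x <= a%:E)%E) ->
  (forall k y, exists b : R, (q k y <= b%:E)%E) ->
  (forall k, exists K (c : R), 0 <= c /\ forall x y (a b : R), (p K x <= a%:E)%E ->
    (q K y <= b%:E)%E -> (r k (B x y) <= (c * (a * b))%:E)%E) ->
  forall k x y, exists K (C : R), forall x' y' (e : R), 0 < e <= 1 ->
    (p K (x - x')%R < e%:E)%E -> (q K (y - y')%R < e%:E)%E ->
    (r k (B x y - B x' y')%R <= (C * e)%:E)%E.
Proof.
move=> BBl BBr rD rN pfin qfin Bbound k x y.
have [K [c [c0 cB]]] := Bbound k.
have [a xa] := pfin K x; have [b yb] := qfin K y.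
exists K, (c * (b + a + 1)) => x' y' e /andP[e0 e1] /ltW xe /ltW ye.
have -> : B x y - B x' y' = B (x - x') y + (B x (y - y') - B (x - x') (y - y')).
  by rewrite !BBl subKr BBr addrA subrK.
apply: le_trans (rD _ _ _) _; apply: le_trans (leeD2l _ (rD _ _ _)) _.
apply: le_trans (leeD2l _ (leeD2l _ (rN _ _))) _.
apply: le_trans (leeD (cB _ _ _ _ xe yb)
  (leeD (cB _ _ _ _ xa ye) (cB _ _ _ _ xe ye))) _.
rewrite -!EFinD lee_fin -!mulrDr -mulrA ler_wpM2l// !mulrDl mul1r addrA.
by rewrite (mulrC e b) lerD2l ler_piMr// ltW.
Qed.

Lemma bilinear_continuous (U V W : topologicalType) (dU : nat -> U -> U -> \bar R)
    (dV : nat -> V -> V -> \bar R) (dW : nat -> W -> W -> \bar R)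
    (B : U * V -> W) :
  (forall x k (e : R), 0 < e -> nbhs x [set x' | (dU k x x' < e%:E)%E]) ->
  (forall y k (e : R), 0 < e -> nbhs y [set y' | (dV k y y' < e%:E)%E]) ->
  (forall w (A : set W), nbhs w A ->
    exists k (e : R), 0 < e /\ forall w', (dW k w w' < e%:E)%E -> A w') ->
  (forall k x y, exists K (C : R), forall x' y' (e : R), 0 < e <= 1 ->
    (dU K x x' < e%:E)%E -> (dV K y y' < e%:E)%E ->
    (dW k (B (x, y)) (B (x', y')) <= (C * e)%:E)%E) ->
  continuous B.
Proof.
move=> nU nV nW est [x y] A /nW[k [e [e0 eA]]].
have [K [C estC]] := est k x y.
have C0 : 0 < `|C| + 1 by rewrite ltr_wpDl.
pose d := Num.min 1 (e / 2 / (`|C| + 1)).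
have d0 : 0 < d by rewrite lt_min ltr01 !divr_gt0.
exists ([set x' | (dU K x x' < d%:E)%E], [set y' | (dV K y y' < d%:E)%E]).
  by split; [exact: nU|exact: nV].
move=> [x' y'] /= [xx' yy']; apply: eA.
apply: le_lt_trans (estC _ _ d _ xx' yy') _; first by rewrite d0 ge_min lexx.
rewrite lte_fin; apply: (@le_lt_trans _ _ (e / 2)); last first.
  by rewrite ltr_pdivrMr// mulrDr mulr1 ltrDl.
have : d <= e / 2 / (`|C| + 1) by rewrite ge_min lexx orbT.
rewrite ler_pdivlMr// mulrC; apply: le_trans.
by rewrite ler_wpM2r ?(ltW d0)// (le_trans (ler_norm _))// lerDl.
Qed.

End BilinearContinuity.

Section Neighbourhoods.
Variables (R : realType) (n : nat).

Lemma nbhs_K1 (f : K1 R n) k (e : R) : 0 < e ->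
  nbhs f [set g : K1 R n | (K1_norm k ((f - g)%R : K1 R n) < e%:E)%E].
Proof.
move=> e0; pose E := [set fg : K1 R n * K1 R n |
  (K1_norm k ((fg.1 - fg.2)%R : K1 R n) < e%:E)%E].
have entE : entourage E by exists k, e; split => // fg; apply.
have := nbhs_entourage f entE; congr nbhs.
by apply/seteqP; split => g; rewrite /xsection/= inE.
Qed.

Lemma nbhs_K1_norm (f : K1 R n) (A : set (K1 R n)) : nbhs f A ->
  exists k (e : R), 0 < e /\
    forall g : K1 R n, (K1_norm k ((f - g)%R : K1 R n) < e%:E)%E -> A g.
Proof.
move=> /nbhsP[E [k [e [e0 eE]]] EA]; exists k, e; split => // g fg.
apply: EA; rewrite /xsection/= inE; apply: eE => j jk /=.
exact: le_lt_trans (K1_norm_homo _ jk) fg.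
Qed.

Lemma nbhs_KU (F : KU R n) k (e : R) : 0 < e ->
  nbhs F [set G : KU R n | (KU_norm k ((F - G)%R : KU R n) < e%:E)%E].
Proof.
move=> e0; pose E := [set FG : KU R n * KU R n |
  (KU_norm k ((FG.1 - FG.2)%R : KU R n) < e%:E)%E].
have entE : entourage E by exists k, e; split => // FG; apply.
have := nbhs_entourage F entE; congr nbhs.
by apply/seteqP; split => g; rewrite /xsection/= inE.
Qed.

Lemma nbhs_KU_norm (F : KU R n) (A : set (KU R n)) : nbhs F A ->
  exists k (e : R), 0 < e /\
    forall G : KU R n, (KU_norm k ((F - G)%R : KU R n) < e%:E)%E -> A G.
Proof.
move=> /nbhsP[E [k [e [e0 eE]]] EA]; exists k, e; split => // G FG.
apply: EA; rewrite /xsection/= inE; apply: eE => j jk /=.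
exact: le_lt_trans (KU_norm_homo _ jk) FG.
Qed.

End Neighbourhoods.

Section Linearity.
Variables (R : realType) (n : nat).
Local Notation mu := (lebesgue_tuple R n).
Local Notation nu := (lebesgue_tuple R n \x lebesgue_tuple R n)%E.

Lemma stft_linl (a : R[i]) (psi phi phi' : 'rV[R]_n -> R[i]) x z :
  rapid phi -> rapid phi' -> rapid psi ->
  stft psi (a *: phi + phi') x z = a * stft psi phi x z + stft psi phi' x z.
Proof.
move=> rphi rphi' rpsi; rewrite /stft -cintegralZ; last exact: stft_cintegrable.
rewrite -cintegralD; last 2 first.
- by apply: cintegrableZ; exact: stft_cintegrable.
- exact: stft_cintegrable.
congr cintegral; apply/funext => s; rewrite /stft_integrand.
by rewrite -[(a *: phi + phi') _]/(a * phi _ + phi' _) !mulrDl !mulrA.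
Qed.

Lemma stft_linr (a : R[i]) (psi psi' phi : 'rV[R]_n -> R[i]) x z :
  rapid phi -> rapid psi -> rapid psi' ->
  stft (a *: psi + psi') phi x z =
  conjc a * stft psi phi x z + stft psi' phi x z.
Proof.
move=> rphi rpsi rpsi'; rewrite /stft -cintegralZ; last exact: stft_cintegrable.
rewrite -cintegralD; last 2 first.
- by apply: cintegrableZ; exact: stft_cintegrable.
- exact: stft_cintegrable.
congr cintegral; apply/funext => s; rewrite /stft_integrand.
rewrite -[(a *: psi + psi') _]/(a * psi _ + psi' _) rmorphD rmorphM/=.
by ring.
Qed.

Lemma synth_linl (a : R[i]) (psi psi' : 'rV[R]_n -> R[i]) F t :
  rapid_symbol F -> rapid psi -> rapid psi' ->
  synth (a *: psi + psi') F t = a * synth psi F t + synth psi' F t.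
Proof.
move=> rF rpsi rpsi'; rewrite /synth -cintegralZ; last exact: synth_cintegrable.
rewrite -cintegralD; last 2 first.
- by apply: cintegrableZ; exact: synth_cintegrable.
- exact: synth_cintegrable.
congr cintegral; apply/funext => s; rewrite /synth_integrand.
by rewrite -[(a *: psi + psi') _]/(a * psi _ + psi' _); ring.
Qed.

Lemma synth_linr (a : R[i]) (psi : 'rV[R]_n -> R[i]) F F' t :
  rapid_symbol F -> rapid_symbol F' -> rapid psi ->
  synth psi (fun x xi => a * F x xi + F' x xi) t =
  a * synth psi F t + synth psi F' t.
Proof.
move=> rF rF' rpsi; rewrite /synth -cintegralZ; last exact: synth_cintegrable.
rewrite -cintegralD; last 2 first.
- by apply: cintegrableZ; exact: synth_cintegrable.
- exact: synth_cintegrable.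
by congr cintegral; apply/funext => s; rewrite /synth_integrand; ring.
Qed.

End Linearity.

Section Operators.
Variables (R : realType) (n : nat).

Lemma rapid_K1_fun (f : K1 R n) : rapid f.
Proof. by case: f => f fP; exact: K1_rapid. Qed.

Lemma rapid_symbol_KU_fun (F : KU R n) : rapid_symbol (real_symbol F).
Proof. by case: F => F FP; exact: KU_rapid_symbol. Qed.

Lemma K1_norm_finite (f : K1 R n) k : (K1_norm k f < +oo)%E.
Proof. by case: f => f /= fP; move: fP; rewrite inE => -[]. Qed.

Lemma KU_norm_finite (F : KU R n) k : (KU_norm k F < +oo)%E.
Proof. by case: F => F /= FP; move: FP; rewrite inE => -[]. Qed.

Definition stft_op (phi psi : K1 R n) : KU R n :=
  MkKU (stft_KU (rapid_K1_fun phi) (rapid_K1_fun psi)).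

Definition adjoint_stft_op (F : KU R n) (psi : K1 R n) : K1 R n :=
  MkK1 (synth_K1 (rapid_symbol_KU_fun F) (rapid_K1_fun psi)).

Lemma stft_op_linl psi : linear (stft_op ^~ psi).
Proof.
move=> a phi phi'; apply: val_inj; apply/funext => x; apply/funext => z.
exact: stft_linl (rapid_K1_fun _) (rapid_K1_fun _) (rapid_K1_fun _).
Qed.

Lemma stft_op_linr phi : linear_for (conjc \; *:%R) (stft_op phi).
Proof.
move=> a psi psi'; apply: val_inj; apply/funext => x; apply/funext => z.
exact: stft_linr (rapid_K1_fun _) (rapid_K1_fun _) (rapid_K1_fun _).
Qed.

Lemma adjoint_stft_op_linl psi : linear (adjoint_stft_op ^~ psi).
Proof.
move=> a F F'; apply: val_inj; apply/funext => t.
exact: synth_linr (rapid_symbol_KU_fun _) (rapid_symbol_KU_fun _) (rapid_K1_fun _).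
Qed.

Lemma adjoint_stft_op_linr F : linear (adjoint_stft_op F).
Proof.
move=> a psi psi'; apply: val_inj; apply/funext => t.
exact: synth_linl (rapid_symbol_KU_fun _) (rapid_K1_fun _) (rapid_K1_fun _).
Qed.

End Operators.

(** * The transforms as continuous operators *)

Section OperatorBounds.
Variables (R : realType) (n : nat).

Lemma K1_smooth (f : K1 R n) : smooth f.
Proof. exact: (rapid_K1_fun f).1. Qed.

Lemma KU_smooth (F : KU R n) z : smooth (F ^~ z).
Proof. by case: F => F /= FP; move: FP; rewrite inE => -[]. Qed.

Lemma K1_normD k (f g : K1 R n) :
  (K1_norm k ((f + g)%R : K1 R n) <= K1_norm k f + K1_norm k g)%E.
Proof.
have := K1_norm_lin k 1 (K1_smooth f) (K1_smooth g).
by rewrite scale1r normc1 mul1e.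
Qed.

Lemma K1_normN k (f : K1 R n) : (K1_norm k ((- f)%R : K1 R n) <= K1_norm k f)%E.
Proof.
have := K1_norm_lin k (-1) (K1_smooth f) (K1_smooth 0).
rewrite scaleN1r normcN normc1 mul1e [(- _ + _)%R]addr0 => /le_trans; apply.
by rewrite -[leRHS]adde0; apply: leeD => //; exact: K1_norm0.
Qed.

Lemma KU_normD k (F G : KU R n) :
  (KU_norm k ((F + G)%R : KU R n) <= KU_norm k F + KU_norm k G)%E.
Proof.
have := KU_norm_lin k 1 (KU_smooth F) (KU_smooth G).
by rewrite scale1r normc1 mul1e.
Qed.

Lemma KU_normN k (F : KU R n) : (KU_norm k ((- F)%R : KU R n) <= KU_norm k F)%E.
Proof.
have := KU_norm_lin k (-1) (KU_smooth F) (KU_smooth 0).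
rewrite scaleN1r normcN normc1 mul1e [(- _ + _)%R]addr0 => /le_trans; apply.
by rewrite -[leRHS]adde0; apply: leeD => //; exact: KU_norm0.
Qed.

Lemma K1_norm_bounded k (f : K1 R n) : exists a : R, (K1_norm k f <= a%:E)%E.
Proof.
exists (fine (K1_norm k f)); rewrite fineK// ge0_fin_numE ?K1_norm_finite//.
exact: K1_norm_ge0.
Qed.

Lemma KU_norm_bounded k (F : KU R n) : exists a : R, (KU_norm k F <= a%:E)%E.
Proof.
exists (fine (KU_norm k F)); rewrite fineK// ge0_fin_numE ?KU_norm_finite//.
exact: KU_norm_ge0.
Qed.

Lemma fine_K1_norm_le k (f : K1 R n) (a : R) :
  (K1_norm k f <= a%:E)%E -> 0 <= fine (K1_norm k f) <= a.
Proof.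
move=> fa; rewrite fine_ge0 ?K1_norm_ge0//= -lee_fin fineK//.
by rewrite ge0_fin_numE ?K1_norm_finite// K1_norm_ge0.
Qed.

Lemma fine_KU_norm_le k (F : KU R n) (a : R) :
  (KU_norm k F <= a%:E)%E -> 0 <= fine (KU_norm k F) <= a.
Proof.
move=> Fa; rewrite fine_ge0 ?KU_norm_ge0//= -lee_fin fineK//.
by rewrite ge0_fin_numE ?KU_norm_finite// KU_norm_ge0.
Qed.

Lemma stft_op_bounded k : exists K (c : R), 0 <= c /\
  forall (phi psi : K1 R n) (a b : R), (K1_norm K phi <= a%:E)%E ->
  (K1_norm K psi <= b%:E)%E -> (KU_norm k (stft_op phi psi) <= (c * (a * b))%:E)%E.
Proof.
pose K := (n * (9 * k + 2) + (k + k))%N.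
exists K, (n.+1%:R ^+ k * (2 ^+ k * (2 * pi ^+ n))); split.
  by rewrite !mulr_ge0 ?exprn_ge0 ?pi_ge0.
move=> phi psi a b /fine_K1_norm_le/andP[a0 phia] /fine_K1_norm_le/andP[b0 psib].
have phiA : decays (9 * k + 2) k (fine (K1_norm K phi)) phi.
  apply: K1_norm_decays; [exact: K1_smooth|exact: K1_norm_finite|exact: leq_addr|].
  by rewrite /K addnA leq_addl.
have psiB : decays k (k + k) (fine (K1_norm K psi)) psi.
  apply: K1_norm_decays; [exact: K1_smooth|exact: K1_norm_finite| |exact: leq_addl].
  apply: leq_trans (leq_addr _ _); rewrite leq_mul2l; apply/orP; right.
  by apply: leq_trans (leq_addr _ _); rewrite leq_pmull.
apply: le_trans (stft_KU_norm (rapid_K1_fun phi) (rapid_K1_fun psi) phiA psiB) _.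
rewrite lee_fin -!mulrA.
do 2 (apply: ler_wpM2l; first by rewrite exprn_ge0).
apply: ler_wpM2l => //; apply: ler_wpM2l; first by rewrite exprn_ge0// pi_ge0.
exact: ler_pM.
Qed.

Lemma adjoint_stft_op_bounded k : exists K (c : R), 0 <= c /\
  forall (F : KU R n) (psi : K1 R n) (a b : R), (KU_norm K F <= a%:E)%E ->
  (K1_norm K psi <= b%:E)%E ->
  (K1_norm k (adjoint_stft_op F psi) <= (c * (a * b))%:E)%E.
Proof.
pose K := (n * (k + 2) + (2 * n + k))%N.
exists K, (9 ^+ k * (2 * weight2_mass R n * n.+1%:R ^+ (2 * n + k))); split.
  by rewrite !mulr_ge0 ?exprn_ge0 ?weight2_mass_ge0.
move=> F psi a b /fine_KU_norm_le/andP[a0 Fa] /fine_K1_norm_le/andP[b0 psib].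
have FA : symbol_decays (k + 2) (2 * n + k)
    (n.+1%:R ^+ (2 * n + k) * fine (KU_norm K F)) (real_symbol F).
  by apply: KU_norm_symbol_decays; [exact: KU_norm_finite|exact: leq_addr|exact: leq_addl].
have psiB : decays k k (fine (K1_norm K psi)) psi.
  apply: K1_norm_decays; [exact: K1_smooth|exact: K1_norm_finite| |].
    by apply: leq_trans (leq_addr _ _); rewrite leq_mul2l leq_addr orbT.
  by rewrite /K !addnA leq_addl.
apply: le_trans (synth_K1_norm (rapid_symbol_KU_fun F) (rapid_K1_fun psi) FA psiB) _.
have M0 := weight2_mass_ge0 R n.
rewrite lee_fin -!mulrA.
apply: ler_wpM2l; first by rewrite exprn_ge0.
do 2 (apply: ler_wpM2l => //); apply: ler_wpM2l; first by rewrite exprn_ge0.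
exact: ler_pM.
Qed.

Lemma continuous_stft_op :
  continuous (fun p : K1 R n * K1 R n => stft_op p.1 p.2).
Proof.
apply: (bilinear_continuous
  (dU := fun k f g => K1_norm k ((f - g)%R : K1 R n))
  (dV := fun k f g => K1_norm k ((f - g)%R : K1 R n))
  (dW := fun k F G => KU_norm k ((F - G)%R : KU R n))).
- exact: nbhs_K1.
- exact: nbhs_K1.
- exact: nbhs_KU_norm.
apply: (bilinear_estimate (p := fun k (f : K1 R n) => K1_norm k f)
  (q := fun k (f : K1 R n) => K1_norm k f) (r := fun k (F : KU R n) => KU_norm k F)).
- by move=> f g psi; exact: (zmod_morphism_linear (stft_op_linl psi)).
- by move=> phi f g; exact: (zmod_morphism_linear (stft_op_linr phi)).
- exact: KU_normD.
- exact: KU_normN.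
- exact: K1_norm_bounded.
- exact: K1_norm_bounded.
- exact: stft_op_bounded.
Qed.

Lemma continuous_adjoint_stft_op :
  continuous (fun p : KU R n * K1 R n => adjoint_stft_op p.1 p.2).
Proof.
apply: (bilinear_continuous
  (dU := fun k F G => KU_norm k ((F - G)%R : KU R n))
  (dV := fun k f g => K1_norm k ((f - g)%R : K1 R n))
  (dW := fun k f g => K1_norm k ((f - g)%R : K1 R n))).
- exact: nbhs_KU.
- exact: nbhs_K1.
- exact: nbhs_K1_norm.
apply: (bilinear_estimate (p := fun k (F : KU R n) => KU_norm k F)
  (q := fun k (f : K1 R n) => K1_norm k f) (r := fun k (f : K1 R n) => K1_norm k f)).
- by move=> F G psi; exact: (zmod_morphism_linear (adjoint_stft_op_linl psi)).
- by move=> F f g; exact: (zmod_morphism_linear (adjoint_stft_op_linr F)).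
- exact: K1_normD.
- exact: K1_normN.
- exact: KU_norm_bounded.
- exact: K1_norm_bounded.
- exact: adjoint_stft_op_bounded.
Qed.

HB.instance Definition _ := isBilinear.Build R[i] (K1 R n) (K1 R n) (KU R n)
  *:%R (conjc \; *:%R) (@stft_op R n)
  (fun psi => zmod_morphism_linear (stft_op_linl psi))
  (fun phi => zmod_morphism_linear (stft_op_linr phi))
  (fun psi => scalable_linear (stft_op_linl psi))
  (fun phi => scalable_linear (stft_op_linr phi)).

HB.instance Definition _ := isBilinear.Build R[i] (KU R n) (K1 R n) (K1 R n)
  *:%R *:%R (@adjoint_stft_op R n)
  (fun psi => zmod_morphism_linear (adjoint_stft_op_linl psi))
  (fun F => zmod_morphism_linear (adjoint_stft_op_linr F))
  (fun psi => scalable_linear (adjoint_stft_op_linl psi))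
  (fun F => scalable_linear (adjoint_stft_op_linr F)).

End OperatorBounds.

Theorem proposition3p1 (R : realType) (n : nat) :
  (exists V : {bilinear K1 R n -> K1 R n -> KU R n | *:%R & conjc \; *:%R},
    [/\ forall (phi psi : K1 R n) (x : 'rV[R]_n) (z : 'rV[R[i]]_n),
          cintegrable (lebesgue_tuple R n)
            (fun s => stft_integrand psi phi x z (row_of_tuple s)),
        forall (phi psi : K1 R n) (x : 'rV[R]_n) (z : 'rV[R[i]]_n),
          V phi psi x z = stft psi phi x z
      & continuous (fun p : K1 R n * K1 R n => V p.1 p.2)]) /\
  (exists W : {bilinear KU R n -> K1 R n -> K1 R n},
    [/\ forall (Phi : KU R n) (psi : K1 R n) (t : 'rV[R]_n),
          cintegrable (lebesgue_tuple R n \x lebesgue_tuple R n)%E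
            (fun s => adjoint_stft_integrand psi Phi t
                        (row_of_tuple s.1) (row_of_tuple s.2)),
        forall (Phi : KU R n) (psi : K1 R n) (t : 'rV[R]_n),
          W Phi psi t = adjoint_stft psi Phi t
      & continuous (fun p : KU R n * K1 R n => W p.1 p.2)]).
Proof.
split.
  exists (@stft_op R n); split; last exact: continuous_stft_op.
    by move=> phi psi x z; apply: stft_cintegrable; exact: rapid_K1_fun.
  by [].
exists (@adjoint_stft_op R n); split; last exact: continuous_adjoint_stft_op.
  move=> F psi t; exact: synth_cintegrable (rapid_symbol_KU_fun F) (rapid_K1_fun psi).
by [].
Qed.
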